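(* Let $\zeta\in\Bbbk$ be a primitive fourth root of unity. The Drinfel'd double $D(T(4,2,1))$ of $T(4,2,1)$ is generated by $g,x,G,X$ subject to the relations $$G^4=g^4=1,\quad x^2=g^2-1,\quad X^2=0,\quad gx=-xg,\quad GX=\zeta XG,$$ $$gG=Gg,\quad gX=-Xg,\quad xX-Xx=G^2-g,\quad xG-\zeta Gx=-2XG(g+G^2).$$ The coalgebra structure is determined by $$\Delta(g)=g\otimes g,\quad \Delta(x)=g\otimes x+x\otimes1,\quad \Delta(G)=G\otimes G-2XG\otimes XG^3,\quad \Delta(X)=1\otimes X+X\otimes G^2,$$ $$\epsilon(g)=\epsilon(G)=1,\quad \epsilon(x)=\epsilon(X)=0.$$
   Context: $\Bbbk$ is an algebraically closed field of characteristic $0$. $T(4,2,1)$ is the Hopf algebra generated by a grouplike element $g$ and an element $x$ with $\Delta(x)=g\otimes x+x\otimes1$, subject to $g^4=1$, $x^2=g^2-1$, $gx=-xg$; it has basis $\{x^kg^\ell\}_{0\le k\le1,\,0\le\ell\le3}$. For a finite-dimensional Hopf algebra $H$ with antipode $S$, the Drinfel'd double $D(H)$ is $H^{*\mathrm{cop}}\otimes H$ as a coalgebra, with unit $\epsilon\otimes1$ and multiplication $$(p\otimes h)(p'\otimes h')=\langle p'_{(1)},S^{-1}(h_{(3)})\rangle\langle p'_{(3)},h_{(1)}\rangle\;p\,p'_{(2)}\otimes h_{(2)}h',$$ where $H^*$ is the dual Hopf algebra (multiplication dual to $\Delta_H$, comultiplication dual to the multiplication of $H$). One writes $p$ for $p\otimes1$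 and $h$ for $\epsilon\otimes h$. Here $g,x$ are the generators of $T(4,2,1)$ and $G,X\in T(4,2,1)^*$ are the elements given by $\langle G,x^kg^\ell\rangle=\delta_{k,0}\zeta^\ell$ and $\langle X,x^kg^\ell\rangle=\delta_{k,1}$ for $0\le k\le1$, $0\le\ell\le3$. *)

(* Defs.v *)
From HB Require Import structures.
From mathcomp Require Import all_boot all_order all_algebra all_field.
From mathcomp Require Import monalg.

Set Implicit Arguments.
Unset Strict Implicit.
Unset Printing Implicit Defensive.

Import GRing.Theory.
Local Open Scope ring_scope.

(* An element of U (x) V is the matrix of its coordinates on the basis
   e_i (x) f_j, where e = vbasis {:U} and f = vbasis {:V}. *)
Definition tensor (K : fieldType) (U V : vectType K) : Type :=
  'M[K]_(\dim {:U}, \dim {:V}).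

HB.instance Definition _ (K : fieldType) (U V : vectType K) :=
  Vector.copy (tensor U V) 'M[K]_(\dim {:U}, \dim {:V}).

Definition pure (K : fieldType) (U V : vectType K) (u : U) (v : V) :
    tensor U V :=
  \matrix_(i, j) (coord (vbasis {:U}) i u * coord (vbasis {:V}) j v).

Notation "u ⊗ v" := (pure u v) (at level 45, left associativity) : ring_scope.

Definition tlift_fun (K : fieldType) (U V W : vectType K) (B : U -> V -> W)
    (t : tensor U V) : W :=
  \sum_i \sum_j t i j *: B (vbasis {:U})`_i (vbasis {:V})`_j.

Fact tlift_fun_is_linear (K : fieldType) (U V W : vectType K)
    (B : U -> V -> W) : linear (tlift_fun B).
Proof.
move=> a s t; rewrite /tlift_fun scaler_sumr -big_split; apply: eq_bigr => i _.
rewrite scaler_sumr -big_split; apply: eq_bigr => j _.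
by rewrite !mxE scalerDl scalerA.
Qed.

HB.instance Definition _ (K : fieldType) (U V W : vectType K)
    (B : U -> V -> W) :=
  GRing.isLinear.Build K (tensor U V) W *:%R (tlift_fun B)
    (tlift_fun_is_linear B).

(* The linear map out of U (x) V induced by a bilinear map B; see tlift_pure. *)
Definition tlift (K : fieldType) (U V W : vectType K) (B : U -> V -> W) :
    'Hom(tensor U V, W) :=
  linfun (tlift_fun B).

Lemma tlift_pure (K : fieldType) (U V W : vectType K) (B : U -> V -> W) u v :
    (forall y, linear (B^~ y)) -> (forall x, linear (B x)) ->
  tlift B (u ⊗ v) = B u v.
Proof.
move=> linl linr; rewrite lfunE /= /tlift_fun.
pose Bl : {linear U -> W} := HB.pack (B^~ v)
  (GRing.isLinear.Build K U W *:%R (B^~ v) (linl v)).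
pose Br x : {linear V -> W} := HB.pack (B x)
  (GRing.isLinear.Build K V W *:%R (B x) (linr x)).
rewrite [in RHS](coord_vbasis (memvf u)) -[RHS]/(Bl _) linear_sum.
apply: eq_bigr => i _; rewrite linearZ /= [in RHS](coord_vbasis (memvf v)).
rewrite -[B _ (\sum_i _)]/(Br _ _) linear_sum scaler_sumr.
by apply: eq_bigr => j _; rewrite linearZ mxE scalerA.
Qed.

Section TensorMaps.

Variable K : fieldType.

Definition tlift3 (U V W X : vectType K) (B : U -> V -> W -> X) :
    'Hom(tensor (tensor U V) W, X) :=
  tlift (fun t w => tlift (fun u v => B u v w) t).

Definition tmap (U U' V V' : vectType K) (f : U -> U') (g : V -> V') :
    'Hom(tensor U V, tensor U' V') :=
  tlift (fun u v => f u ⊗ g v).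

Definition tassoc (U V W : vectType K) :
    'Hom(tensor (tensor U V) W, tensor U (tensor V W)) :=
  tlift3 (fun u v w => u ⊗ (v ⊗ w)).

Definition tmul (A B : vectType K) (mulA : A -> A -> A) (mulB : B -> B -> B)
    (s t : tensor A B) : tensor A B :=
  tlift (fun a b => tlift (fun a' b' => mulA a a' ⊗ mulB b b') t) s.

End TensorMaps.

(* An algebra is given here by a vector space with a product and a unit, so
   that the notions also apply to the product defined on a Drinfel'd double. *)

Definition alg_morphism (K : fieldType) (A B : lmodType K)
    (mulA : A -> A -> A) (oneA : A) (mulB : B -> B -> B) (oneB : B)
    (f : A -> B) : Prop :=
  [/\ linear f, f oneA = oneB & {morph f : a b / mulA a b >-> mulB a b}].

(* f is the one and only algebra morphism such that P f. *)
Definition alg_morphism_determined_by (K : fieldType) (A B : lmodType K)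
    (mulA : A -> A -> A) (oneA : A) (mulB : B -> B -> B) (oneB : B)
    (f : A -> B) (P : (A -> B) -> Prop) : Prop :=
  let morphism := alg_morphism mulA oneA mulB oneB in
  [/\ morphism f, P f & forall f', morphism f' -> P f' -> f' =1 f].

Notation free_alg K n := {malg K[{fmonom 'I_n}]} (only parsing).

Definition fvar (K : fieldType) (n : nat) (i : 'I_n) : free_alg K n :=
  << fmu i >>.

(* The two-sided ideal generated by the differences l - r, for (l, r) \in E. *)
Inductive ideal_gen (R : pzRingType) (E : seq (R * R)) : R -> Prop :=
| IdealGen e of e \in E : ideal_gen E (e.1 - e.2)
| Ideal0 : ideal_gen E 0
| IdealD a b of ideal_gen E a & ideal_gen E b : ideal_gen E (a + b)
| IdealMl a b of ideal_gen E b : ideal_gen E (a * b)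
| IdealMr a b of ideal_gen E a : ideal_gen E (a * b).

(* The algebra A is generated by s subject to the relations l = r for
   (l, r) \in E: the map 'X_i |-> s_i extends to a surjective morphism from
   the free algebra to A whose kernel is the ideal generated by E. *)
Definition presented_by (K : fieldType) (A : lmodType K)
    (mul : A -> A -> A) (one : A) (n : nat) (s : n.-tuple A)
    (E : seq (free_alg K n * free_alg K n)) : Prop :=
  exists phi : free_alg K n -> A,
    [/\ alg_morphism *%R 1 mul one phi,
        forall i, phi (fvar K i) = tnth s i,
        forall a, exists p, phi p = a
      & forall p, phi p = 0 <-> ideal_gen E p].

HB.mixin Record Falgebra_isHopf (K : fieldType) H of Falgebra K H := {
  comul : 'Hom(H, tensor H H);
  counit : 'Hom(H, K^o);
  antipode : 'End(H);
  comulA : forall h,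
    tassoc H H H (tmap comul id (comul h)) = tmap id comul (comul h);
  counitl : forall h, tlift (fun a b => counit a *: b) (comul h) = h;
  counitr : forall h, tlift (fun a b => counit b *: a) (comul h) = h;
  comul1 : comul 1 = 1 ⊗ 1;
  comulM : {morph comul : a b / a * b >-> tmul *%R *%R a b};
  counit1 : counit 1 = 1;
  counitM : {morph counit : a b / a * b};
  antipodel : forall h,
    tlift (fun a b => antipode a * b) (comul h) = counit h *: 1;
  antipoder : forall h,
    tlift (fun a b => a * antipode b) (comul h) = counit h *: 1
}.

#[short(type="hopfAlgType")]
HB.structure Definition HopfAlgebra (K : fieldType) :=
  { H of Falgebra K H & Falgebra_isHopf K H }.

Section DrinfeldDouble.

Variables (K : fieldType) (H : hopfAlgType K).

Definition hdual : Type := 'Hom(H, K^o).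
HB.instance Definition _ := Vector.copy hdual 'Hom(H, K^o).
Coercion fun_of_dual (p : hdual) : H -> K^o := fun_of_lfun p.

Definition dual_mul (p q : hdual) : hdual :=
  (tlift (fun a b => (p a * q b : K^o)) \o comul)%VF.

Definition dual_basis (i : 'I_(\dim {:H})) : hdual :=
  linfun (coord (vbasis {:H}) i : H -> K^o).

(* The comultiplication of H^*, characterized by dual_comulE. *)
Definition dual_comul (p : hdual) : tensor hdual hdual :=
  \sum_(i < \dim {:H}) \sum_(j < \dim {:H})
    p ((vbasis {:H})`_i * (vbasis {:H})`_j) *: (dual_basis i ⊗ dual_basis j).

Lemma dual_comulE (p : hdual) (a b : H) :
  tlift (fun q r : hdual => (q a * r b : K^o)) (dual_comul p) = p (a * b).
Proof.
rewrite [in RHS](coord_vbasis (memvf a)) mulr_suml /fun_of_dual linear_sum.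
rewrite linear_sum; apply: eq_bigr => i _.
rewrite linear_sum [in RHS](coord_vbasis (memvf b)) mulr_sumr linear_sum.
apply: eq_bigr => j _; rewrite linearZ /= tlift_pure.
- rewrite -scalerAl -scalerAr !linearZ /= !lfunE /=; congr (_ *: _).
  exact: mulrC.
- by move=> r c q q'; rewrite !lfunE /= lfunE /= mulrDl scalerAl.
- by move=> q c r r'; rewrite !lfunE /= lfunE /= mulrDr scalerAr.
Qed.

Definition drinfeld_double : Type := tensor hdual H.
HB.instance Definition _ := Vector.copy drinfeld_double (tensor hdual H).

Definition double_in_dual (p : hdual) : drinfeld_double := p ⊗ (1 : H).
Definition double_in (h : H) : drinfeld_double := (counit : hdual) ⊗ h.

Definition double_one : drinfeld_double := (counit : hdual) ⊗ (1 : H).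

(* The product of p (x) h and p' (x) h'. Both Sweedler expansions are those of
   H^* and H themselves, not of H^{*cop}. The antipode of a finite-dimensional
   Hopf algebra is bijective, hence antipode^-1 is its inverse. *)
Definition double_mul_pure (p : hdual) (h : H) (p' : hdual) (h' : H) :
    drinfeld_double :=
  tlift3 (fun h1 h2 h3 : H =>
    tlift3 (fun p'1 p'2 p'3 : hdual =>
      (p'1 ((antipode^-1)%VF h3) * p'3 h1)
        *: (dual_mul p p'2 ⊗ (h2 * h')) : drinfeld_double)
      (tmap dual_comul id (dual_comul p')))
    (tmap comul id (comul h)).

Definition double_mul (a b : drinfeld_double) : drinfeld_double :=
  tlift (fun p h => tlift (double_mul_pure p h) b) a.

(* The coalgebra structure of H^{*cop} (x) H: the factors of the
   comultiplication of H^* are exchanged. *)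
Definition double_comul :
    'Hom(drinfeld_double, tensor drinfeld_double drinfeld_double) :=
  tlift (fun (p : hdual) (h : H) =>
    tlift (fun p1 p2 : hdual =>
      tlift (fun h1 h2 : H =>
        (p2 ⊗ h1 : drinfeld_double) ⊗ (p1 ⊗ h2 : drinfeld_double))
        (comul h))
      (dual_comul p)).

Definition double_counit : 'Hom(drinfeld_double, K^o) :=
  tlift (fun (p : hdual) (h : H) => (p 1 * counit h : K^o)).

End DrinfeldDouble.

Notation "a *D b" := (double_mul a b)
  (at level 40, left associativity) : ring_scope.

(* T is the Hopf algebra T(4,2,1), with generators g and x. The values of the
   counit and antipode on g and x follow from those of comul. The last clause,
   a consequence of the presentation, is the basis of T(4,2,1) on which
   functionals are defined. *)
Definition is_T421 (K : fieldType) (T : hopfAlgType K) (g x : T) : Prop :=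
  [/\ let g' := fvar K (0 : 'I_2) in
      let x' := fvar K (1 : 'I_2) in
      presented_by *%R 1 [tuple g; x]
        [:: (g' ^+ 4, 1); (x' ^+ 2, g' ^+ 2 - 1); (g' * x', - (x' * g'))],
      comul g = g ⊗ g,
      comul x = g ⊗ x + x ⊗ 1
    & basis_of {:T} [seq x ^+ k * g ^+ l | k <- iota 0 2, l <- iota 0 4]].

(* Main.v *)
From HB Require Import structures.
Require Import Defs.
From mathcomp Require Import all_boot all_order all_algebra all_field.
From mathcomp Require Import finmap monalg.

Set Implicit Arguments.
Unset Strict Implicit.
Unset Printing Implicit Defensive.

Import GRing.Theory.
Local Open Scope ring_scope.

(** An element h of H acts on the double by
      h (q # k) = sum q(S^-1(h_3) ? h_1) # h_2 k,
    and a functional p by p (q # k) = pq # k. The elements a such that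
    a(bc) = (ab)c for all b, c form a subalgebra; it contains all functionals,
    and for the group-like g and the skew-primitive x this is a direct
    computation with Delta(g) and Delta(x). As these generate the double, it is
    associative. In the same way the multiplicativity of the comultiplication
    and of the counit is only checked on these elements.

    The functionals X^a G^b (a < 2, b < 4) span T(4,2,1)^* by Fourier inversion
    on Z/4, so g, x, G, X generate the double, and the ten relations are checked
    by evaluating functionals. Conversely, modulo the relations every word is a
    combination of the 64 words X^a G^b x^c g^d. Their images span the double,
    which has dimension 64, so they are independent and there are no further
    relations. *)

(** * Linear functions and tensor products *)

(** The Hopf axioms at hand do not say that the antipode S reverses products or is injective, while
    the action of H needs S^-1(ab) = S^-1(b) S^-1(a). Both facts are therefore hypotheses in the
    general sections. For T they are proved by hand: the antipode axiom gives S on the basis x^k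
    g^l, anti-multiplicativity is checked there with g or x as left factor, and S^4 = id gives
    injectivity.

    Everything about x comes from its iterated coproduct g ⊗ g ⊗ x + g ⊗ x ⊗ 1 + x ⊗ 1 ⊗ 1: it makes
    x act through three operators on functionals, q(-x g^-1 ? g), q(? g) and q(? x). Their values at
    G and X give the last two relations. The constant -2 is zeta^2 - 1, brought in by x^2 = g^2 - 1;
    for the same reason G fails to be group-like. The exchange of legs in the co-opposite dual turns
    the term XG^3 ⊗ XG of the dual into XG ⊗ XG^3 in the double. *)

Section LinearFunctions.

Context {K : fieldType} {U V : lmodType K} {f : U -> V}.
Hypothesis lf : linear f.

Let F : {linear U -> V} := HB.pack f (GRing.isLinear.Build K U V *:%R f lf).

Lemma linD u v : f (u + v) = f u + f v. Proof. exact: (raddfD F). Qed.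
Lemma lin0 : f 0 = 0. Proof. exact: (raddf0 F). Qed.
Lemma linN u : f (- u) = - f u. Proof. exact: (raddfN F). Qed.
Lemma linB u v : f (u - v) = f u - f v. Proof. exact: (raddfB F). Qed.
Lemma linZ a u : f (a *: u) = a *: f u. Proof. exact: (linearZZ F). Qed.
Lemma lin_sum I (r : seq I) P (E : I -> U) :
  f (\sum_(i <- r | P i) E i) = \sum_(i <- r | P i) f (E i).
Proof. exact: (raddf_sum F). Qed.

End LinearFunctions.

(** Linearity stays a property of bare functions, in the form that [tlift_pure] asks for, since the
    maps at hand are mostly partial applications and abstractions. *)
Definition bilin (K : fieldType) (U V W : lmodType K) (B : U -> V -> W) : Prop :=
  (forall y, linear (B^~ y)) /\ (forall x, linear (B x)).

Lemma linfunE (K : fieldType) (U V : vectType K) (f : U -> V) u :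
  linear f -> linfun f u = f u.
Proof.
move=> lf.
exact: (lfunE (HB.pack_for {linear U -> V} f (GRing.isLinear.Build K U V *:%R f lf))).
Qed.

Section Tensor.

Context {K : fieldType}.
Implicit Types U V W X Y : vectType K.

Lemma pure_bilin U V : bilin (@pure K U V).
Proof.
split=> y a u v; apply/matrixP=> i j; rewrite !mxE linearP.
  by rewrite mulrDl mulrA.
by rewrite mulrDr mulrCA.
Qed.

Lemma pure_linl U V (v : V) : linear (fun u : U => u ⊗ v).
Proof. exact: (pure_bilin U V).1. Qed.

Lemma pure_linr U V (u : U) : linear (fun v : V => u ⊗ v).
Proof. exact: (pure_bilin U V).2. Qed.

Lemma tlift_sum U V W (B : U -> V -> W) t :
  tlift B t = \sum_i \sum_j t i j *: B (vbasis {:U})`_i (vbasis {:V})`_j.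
Proof. by rewrite lfunE. Qed.

(** Read backwards, this expands a tensor in the basis of pure tensors; [tensor_ind] rests on it. *)
Lemma tlift_pureK U V (t : tensor U V) : tlift (@pure K U V) t = t.
Proof.
rewrite tlift_sum; apply/matrixP=> i j.
rewrite summxE (bigD1 i) //= summxE (bigD1 j) //= !mxE.
rewrite !coord_free ?(basis_free (vbasisP _)) // !eqxx !mulr1.
rewrite big1 ?addr0 => [|j' nj].
  rewrite big1 ?addr0 // => i' ni; rewrite summxE big1 // => j' _.
  by rewrite !mxE !coord_free ?(basis_free (vbasisP _)) // (negPf ni) mul0r mulr0.
by rewrite !mxE !coord_free ?(basis_free (vbasisP _)) // (negPf nj) !mulr0.
Qed.

(** A scalar coefficient is absorbed into the first factor of a pure tensor, so closure under sums
    suffices. *)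
Lemma tensor_ind U V (P : tensor U V -> Prop) :
    P 0 -> (forall s t, P s -> P t -> P (s + t)) ->
  (forall u v, P (u ⊗ v)) -> forall t, P t.
Proof.
move=> P0 PD Ppure t; rewrite -[t]tlift_pureK tlift_sum.
elim/big_ind: _ => // i _; elim/big_ind: _ => // j _.
by rewrite -(linZ (pure_linl _)).
Qed.

Lemma tensor_lin_eq U V (W : lmodType K) (f g : tensor U V -> W) :
    linear f -> linear g -> (forall u v, f (u ⊗ v) = g (u ⊗ v)) -> f =1 g.
Proof.
move=> lf lg fg; elim/tensor_ind => [|s t IHs IHt|//]; first by rewrite !lin0.
by rewrite (linD lf) (linD lg) IHs IHt.
Qed.

Lemma eq_tlift U V W (B B' : U -> V -> W) t :
  (forall u v, B u v = B' u v) -> tlift B t = tlift B' t.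
Proof.
move=> eqB; rewrite !tlift_sum.
by apply: eq_bigr => i _; apply: eq_bigr => j _; rewrite eqB.
Qed.

Lemma tlift_comp U V W X (f : W -> X) (B : U -> V -> W) t :
  linear f -> f (tlift B t) = tlift (fun u v => f (B u v)) t.
Proof.
move=> lf; rewrite !tlift_sum (lin_sum lf); apply: eq_bigr => i _.
by rewrite (lin_sum lf); apply: eq_bigr => j _; rewrite (linZ lf).
Qed.

(** [tlift B] is linear in the tensor by construction; this covers the other case, where the varying
    argument sits inside the map [B]. Bilinearity of nested [tlift] expressions needs both. *)
Lemma tlift_linear_param U V W X (B : X -> U -> V -> W) t :
  (forall u v, linear (fun x => B x u v)) -> linear (fun x => tlift (B x) t).
Proof.
move=> lB a x y; rewrite !tlift_sum scaler_sumr -big_split; apply: eq_bigr => i _.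
rewrite scaler_sumr -big_split; apply: eq_bigr => j _.
by rewrite lB scalerDr !scalerA mulrC.
Qed.

Lemma tliftE U V W (B : U -> V -> W) u v : bilin B -> tlift B (u ⊗ v) = B u v.
Proof. by case=> Bl Br; apply: tlift_pure. Qed.

Lemma tmap_pure U U' V V' (f : U -> U') (g : V -> V') u v :
  linear f -> linear g -> tmap f g (u ⊗ v) = f u ⊗ g v.
Proof.
move=> lf lg; apply: tliftE; split=> y a w z.
  by rewrite lf pure_linl.
by rewrite lg pure_linr.
Qed.

Lemma tlift_tmap U U' V V' W (f : U -> U') (g : V -> V') (B : U' -> V' -> W) t :
    linear f -> linear g -> bilin B ->
  tlift B (tmap f g t) = tlift (fun u v => B (f u) (g v)) t.
Proof.
move=> lf lg lB; rewrite /tmap (tlift_comp (f := tlift B)); last exact: linearP.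
by apply: eq_tlift => u v; rewrite tliftE.
Qed.

Lemma tmap_id U V (t : tensor U V) : tmap id id t = t.
Proof. by rewrite /tmap tlift_pureK. Qed.

Lemma tlift3_linear_param U V W X Y (B : Y -> U -> V -> W -> X) t :
  (forall u v w, linear (fun y => B y u v w)) -> linear (fun y => tlift3 (B y) t).
Proof.
move=> lB; apply: (tlift_linear_param (B := fun y t' w =>
  tlift (fun u v => B y u v w) t')) => t' w.
exact: (tlift_linear_param (B := fun y u v => B y u v w)).
Qed.

Lemma tlift3_comp U V W X Y (f : X -> Y) (B : U -> V -> W -> X) t :
  linear f -> f (tlift3 B t) = tlift3 (fun u v w => f (B u v w)) t.
Proof.
move=> lf; rewrite /tlift3 (tlift_comp _ _ lf).
by apply: eq_tlift => u w; rewrite (tlift_comp _ _ lf).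
Qed.

Lemma eq_tlift3 U V W X (B B' : U -> V -> W -> X) t :
  (forall u v w, B u v w = B' u v w) -> tlift3 B t = tlift3 B' t.
Proof. by move=> eqB; apply: eq_tlift => u w; apply: eq_tlift. Qed.

Lemma tassoc_pure U V W (u : U) (v : V) (w : W) :
  tassoc U V W (u ⊗ v ⊗ w) = u ⊗ (v ⊗ w).
Proof.
rewrite /tassoc /tlift3 tliftE.
  by rewrite tliftE //; split=> y k a b; rewrite !(pure_linl, pure_linr).
split=> y; first exact: linearP.
apply: (tlift_linear_param (B := fun w u v => u ⊗ (v ⊗ w))) => a b k c d.
by rewrite !pure_linr.
Qed.

Lemma tmul_bilin (A B : vectType K) mulA mulB :
  bilin (@tmul K A B mulA mulB).
Proof.
split=> [t|s]; first exact: linearP.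
apply: (tlift_linear_param (B := fun t a b =>
  tlift (fun a' b' => mulA a a' ⊗ mulB b b') t)) => u v.
exact: linearP.
Qed.

Lemma tmul_pure (A B : vectType K) mulA mulB (a a' : A) (b b' : B) :
    bilin mulA -> bilin mulB ->
  tmul mulA mulB (a ⊗ b) (a' ⊗ b') = mulA a a' ⊗ mulB b b'.
Proof.
move=> [lAl lAr] [lBl lBr]; have lin x y : bilin (fun u v => mulA x u ⊗ mulB y v).
  split=> z c u v; first by rewrite lAr pure_linl.
  by rewrite lBr pure_linr.
rewrite /tmul tliftE; first exact: tliftE.
split=> z.
  apply: (tlift_linear_param (B := fun x u v => mulA x u ⊗ mulB z v)) => u v c x y.
  by rewrite lAl pure_linl.
apply: (tlift_linear_param (B := fun x u v => mulA z u ⊗ mulB x v)) => u v c x y.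
by rewrite lBl pure_linr.
Qed.

Lemma tmulA (A B : vectType K) (mulA : A -> A -> A) (mulB : B -> B -> B) :
    bilin mulA -> bilin mulB -> associative mulA -> associative mulB ->
  associative (tmul mulA mulB).
Proof.
move=> lA lB assA assB r s t; have [tl tr] := tmul_bilin mulA mulB.
elim/tensor_ind: r => [|r r' IHr IHr'|a b]; first by rewrite !(lin0 (tl _)).
  by rewrite !(linD (tl _)) IHr IHr'.
elim/tensor_ind: s => [|s s' IHs IHs'|a' b'].
- by rewrite !(lin0 (tl _), lin0 (tr _)).
- by rewrite !(linD (tl _), linD (tr _)) IHs IHs'.
elim/tensor_ind: t => [|s s' IHs IHs'|a'' b''].
- by rewrite !(lin0 (tr _)).
- by rewrite !(linD (tr _)) IHs IHs'.
by rewrite !tmul_pure // assA assB.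
Qed.

End Tensor.

(** * The dual of a Hopf algebra *)

Section Dual.

Context {K : fieldType} {H : hopfAlgType K}.
(* Without K, rewriting fails to infer the field from the structure of H. *)
Local Notation tliftEK := (tliftE (K := K)).
Local Notation tlift_tmapK := (tlift_tmap (K := K)).
Implicit Types (p q r : hdual H) (a b c d s t : H).

Lemma dualP p : linear (p : H -> K^o).
Proof. exact: linearP. Qed.

Lemma hdual_eq p q : (forall a, p a = q a) -> p = q.
Proof. by move=> pq; apply/lfunP. Qed.

Lemma hdualE (c : K) p q a : (c *: p + q : hdual H) a = c * p a + q a.
Proof. by rewrite /fun_of_dual lfunE /= lfunE. Qed.
Lemma hdualDE p q a : (p + q : hdual H) a = p a + q a.
Proof. by rewrite /fun_of_dual lfunE. Qed.
Lemma hdualZE (c : K) p a : (c *: p : hdual H) a = c * p a.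
Proof. by rewrite /fun_of_dual lfunE. Qed.
Lemma hdualNE p a : (- p : hdual H) a = - p a.
Proof. by rewrite /fun_of_dual lfunE. Qed.
Lemma hdual0E a : (0 : hdual H) a = 0.
Proof. by rewrite /fun_of_dual lfunE. Qed.

Lemma hdualM_bilin p q : bilin (fun a b => p a * q b : K^o).
Proof.
split=> y a u v; first by rewrite (dualP p) mulrDl -mulrA.
by rewrite (dualP q) mulrDr mulrCA.
Qed.

Lemma dual_mulE p q a :
  dual_mul p q a = tlift (fun b c => p b * q c : K^o) (comul a).
Proof. by rewrite /fun_of_dual comp_lfunE. Qed.

Lemma dual_mul_bilin : bilin (@dual_mul K H).
Proof.
split=> y c u v; apply: hdual_eq => a; rewrite hdualE !dual_mulE.
  apply: (tlift_linear_param (B := fun (p : hdual H) b c => p b * y c : K^o)).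
  by move=> b d k p q; rewrite hdualE mulrDl -mulrA.
apply: (tlift_linear_param (B := fun (p : hdual H) b c => y b * p c : K^o)).
by move=> b d k p q; rewrite hdualE mulrDr mulrCA.
Qed.

(** Coassociativity transposed: [F] and [F'] evaluate p, q, r on the two bracketings of a threefold
    tensor and agree along [tassoc]. *)
Lemma dual_mulA : associative (@dual_mul K H).
Proof.
move=> p q r; apply: hdual_eq => a.
pose F (t : tensor H (tensor H H)) : K^o :=
  tlift (fun b u => p b * tlift (fun c d => q c * r d : K^o) u : K^o) t.
pose F' (t : tensor (tensor H H) H) : K^o :=
  tlift (fun u b => tlift (fun c d => p c * q d : K^o) u * r b : K^o) t.
have lF : bilin (fun b (u : tensor H H) =>
    p b * tlift (fun c d => q c * r d : K^o) u : K^o).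
  split=> y c u v; first by rewrite (dualP p) mulrDl -mulrA.
  by rewrite linearP mulrDr mulrCA.
have lF' : bilin (fun (u : tensor H H) b =>
    tlift (fun c d => p c * q d : K^o) u * r b : K^o).
  split=> y c u v; last by rewrite (dualP r) mulrDr mulrCA.
  by rewrite linearP mulrDl -mulrA.
have FF' (t : tensor (tensor H H) H) : F (tassoc H H H t) = F' t.
  move: t; apply: tensor_lin_eq => [c u v|c u v|u b].
  - by rewrite /F !linearP.
  - by rewrite /F' !linearP.
  move: u; apply: tensor_lin_eq => [c' u v|c' u v|c d].
  - by rewrite pure_linl /F !linearP.
  - by rewrite pure_linl /F' !linearP.
  rewrite tassoc_pure /F /F' /reverse_coercion (tliftE _ _ lF) (tliftE _ _ lF').
  by rewrite !(tliftE _ _ (hdualM_bilin _ _)) mulrA.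
have := FF' (tmap comul id (comul a)); rewrite comulA /F /F'.
rewrite !tlift_tmapK //; try exact: linearP.
rewrite !dual_mulE => E; transitivity (F (tmap id comul (comul a))).
  rewrite /F tlift_tmapK //; last exact: linearP.
  by apply: eq_tlift => b c; rewrite dual_mulE.
rewrite /F tlift_tmapK //; last exact: linearP.
by rewrite E; apply: eq_tlift => b c; rewrite dual_mulE.
Qed.

Lemma dual_mul1p p : dual_mul (counit : hdual H) p = p.
Proof.
apply: hdual_eq => a; rewrite dual_mulE -[in RHS](counitl a).
rewrite (tlift_comp (f := p : H -> K^o)); last exact: dualP.
by apply: eq_tlift => b c; rewrite (linZ (dualP p)).
Qed.

Lemma dual_mulp1 p : dual_mul p (counit : hdual H) = p.
Proof.
apply: hdual_eq => a; rewrite dual_mulE -[in RHS](counitr a).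
rewrite (tlift_comp (f := p : H -> K^o)); last exact: dualP.
by apply: eq_tlift => b c; rewrite (linZ (dualP p)) mulrC.
Qed.

Definition dual_act s t p : hdual H := (p \o (amulr t \o amull s))%VF.

Lemma dual_actE s t p a : dual_act s t p a = p (s * a * t).
Proof. by rewrite /fun_of_dual !comp_lfunE /= !lfunE. Qed.

Lemma dual_act_lin s t : linear (dual_act s t).
Proof. by move=> c p q; apply: hdual_eq => a; rewrite !(dual_actE, hdualE). Qed.

Lemma dual_act_bilin p : bilin (fun s t => dual_act s t p).
Proof.
split=> y c u v; apply: hdual_eq => a; rewrite hdualE !dual_actE -(dualP p).
  by rewrite !mulrDl -!scalerAl.
by rewrite mulrDr -scalerAr.
Qed.

(** Left multipliers compose in reverse order. Combined with S^-1, which also reverses products,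
    this makes q(S^-1(h_3) ? h_1) a left action of h. *)
Lemma dual_act_comp s t s' t' p :
  dual_act s t (dual_act s' t' p) = dual_act (s' * s) (t * t') p.
Proof. by apply: hdual_eq => a; rewrite !dual_actE !mulrA. Qed.

Lemma dual_act1 p : dual_act 1 1 p = p.
Proof. by apply: hdual_eq => a; rewrite dual_actE mul1r mulr1. Qed.

Lemma dual_eval_bilin a b : bilin (fun q r : hdual H => q a * r b : K^o).
Proof.
split=> y c u v; rewrite hdualE; first by rewrite mulrDl -mulrA.
by rewrite mulrDr mulrCA.
Qed.

(** By finite dimension a tensor is recovered, through [F], from its values at pairs of basis
    vectors and the dual basis. With [dual_comulE] this turns identities on [dual_comul] into
    evaluations. *)
Lemma dual_tensor_eq (s t : tensor (hdual H) (hdual H)) :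
    (forall a b, tlift (fun q r : hdual H => q a * r b : K^o) s =
                 tlift (fun q r : hdual H => q a * r b : K^o) t) -> s = t.
Proof.
pose e := vbasis {:H}.
pose F (u : tensor (hdual H) (hdual H)) :=
  \sum_(i < \dim {:H}) \sum_(j < \dim {:H})
  tlift (fun q r : hdual H => q e`_i * r e`_j : K^o) u
    *: (dual_basis i ⊗ dual_basis j).
have dual_sum p : p = \sum_(i < \dim {:H}) p e`_i *: dual_basis i.
  apply: hdual_eq => a; rewrite [in LHS](coord_vbasis (memvf a)).
  rewrite (lin_sum (dualP p)) /fun_of_dual sum_lfunE; apply: eq_bigr => i _.
  by rewrite linearZ lfunE /= lfunE; apply: mulrC.
suff Fid u : F u = u.
  move=> eq_st; rewrite -[s]Fid -[t]Fid.
  by apply: eq_bigr => i _; apply: eq_bigr => j _; rewrite eq_st.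
apply: (tensor_lin_eq (f := F) (g := id)) => // [c v w|q r].
  rewrite /F scaler_sumr -big_split; apply: eq_bigr => i _.
  rewrite scaler_sumr -big_split; apply: eq_bigr => j _.
  by rewrite linearP scalerDl scalerA.
rewrite [in RHS](dual_sum q) (lin_sum (pure_linl _)); apply: eq_bigr => i _.
rewrite (linZ (pure_linl _)) [in RHS](dual_sum r) (lin_sum (pure_linr _)).
rewrite scaler_sumr; apply: eq_bigr => j _; rewrite tliftEK.
  by rewrite (linZ (pure_linr _)) scalerA.
exact: dual_eval_bilin.
Qed.

Lemma dual_comul_lin : linear (@dual_comul K H).
Proof.
move=> c p q; apply: dual_tensor_eq => a b.
by rewrite linearP /= !dual_comulE hdualE.
Qed.

(** Evaluated at y and z, both sides are p(a y b c z d): only the product of what stands between the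
    two arguments matters, so it can be collected in the first leg. *)
Lemma tmap_dual_act a b c d p :
  tmap (dual_act a b) (dual_act c d) (dual_comul p) =
  tmap (dual_act a (b * c)) (dual_act 1 d) (dual_comul p).
Proof.
apply: dual_tensor_eq => y z.
have bil := dual_eval_bilin y z.
rewrite !tlift_tmapK //; try exact: dual_act_lin.
transitivity (p (a * y * b * (c * z * d))).
  by rewrite -dual_comulE; apply: eq_tlift => q r; rewrite !dual_actE.
rewrite -[RHS](eq_tlift (B := fun q r : hdual H =>
   q (a * y * (b * c)) * r (1 * z * d) : K^o)); last first.
  by move=> q r; rewrite !dual_actE.
by rewrite dual_comulE mul1r !mulrA.
Qed.

Lemma dual_comul_act a d p :
  dual_comul (dual_act a d p) = tmap (dual_act a 1) (dual_act 1 d) (dual_comul p).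
Proof.
apply: dual_tensor_eq => y z.
have bil := dual_eval_bilin y z.
rewrite !tlift_tmapK //; try exact: dual_act_lin.
rewrite dual_comulE dual_actE.
rewrite -[RHS](eq_tlift (B := fun q r : hdual H =>
   q (a * y * 1) * r (1 * z * d) : K^o)); last first.
  by move=> q r; rewrite !dual_actE.
by rewrite dual_comulE mulr1 mul1r !mulrA.
Qed.

(** Contracting the second leg of the coproduct at t yields p(? t), because the sum of q(a) r(t) is
    p(a t). *)
Lemma tlift_dual_comull (W : vectType K) (F : hdual H -> W) t p :
    linear F ->
  tlift (fun q r : hdual H => r t *: F q) (dual_comul p) = F (dual_act 1 t p).
Proof.
move=> lF; transitivity (F (tlift (fun q r : hdual H => r t *: q) (dual_comul p))).
  by rewrite (tlift_comp _ _ lF); apply: eq_tlift => q r; rewrite (linZ lF).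
congr (F _); apply: hdual_eq => a; rewrite dual_actE mul1r -dual_comulE.
rewrite (tlift_comp (f := fun q : hdual H => q a : K^o)).
  by apply: eq_tlift => q r; rewrite hdualZE mulrC.
by move=> c q r; rewrite hdualE.
Qed.

Lemma tlift_dual_comulr (W : vectType K) (F : hdual H -> W) s p :
    linear F ->
  tlift (fun q r : hdual H => q s *: F r) (dual_comul p) = F (dual_act s 1 p).
Proof.
move=> lF; transitivity (F (tlift (fun q r : hdual H => q s *: r) (dual_comul p))).
  by rewrite (tlift_comp _ _ lF); apply: eq_tlift => q r; rewrite (linZ lF).
congr (F _); apply: hdual_eq => a; rewrite dual_actE mulr1 -dual_comulE.
rewrite (tlift_comp (f := fun q : hdual H => q a : K^o)).
  by apply: eq_tlift => q r; rewrite hdualZE.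
by move=> c q r; rewrite hdualE.
Qed.

(** This replaces the Sweedler sum over p' in the product of the double by the single functional
    p'(s ? t). The third leg is contracted before the first, following the bracketing of the
    iterated coproduct. *)
Lemma tlift3_dual_comul (W : vectType K) (F : hdual H -> W) s t p :
    linear F ->
  tlift3 (fun p1 p2 p3 : hdual H => (p1 s * p3 t) *: F p2)
    (tmap (@dual_comul K H) id (dual_comul p)) = F (dual_act s t p).
Proof.
move=> lF; rewrite /tlift3 tlift_tmapK //; last 2 first.
- exact: dual_comul_lin.
- split=> y; first exact: linearP.
  apply: (tlift_linear_param
    (B := fun w u v : hdual H => (u s * w t) *: F v)) => u v c r r'.
  by rewrite hdualE mulrDr scalerDl mulrCA scalerA.
have -> : dual_act s t p = dual_act s 1 (dual_act 1 t p).
  by rewrite dual_act_comp !mul1r.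
rewrite -(tlift_dual_comull (F := fun q => F (dual_act s 1 q))).
  apply: eq_tlift => q r; rewrite -tlift_dual_comulr //.
  rewrite (tlift_comp (K := K) (f := fun w : W => r t *: w)); last first.
    by move=> c u v; rewrite scalerDr !scalerA mulrC.
  by apply: eq_tlift => u v; rewrite scalerA mulrC.
by move=> c u v; rewrite dual_act_lin lF.
Qed.

End Dual.

(** * Multiplicativity of the comultiplication of the dual *)

Section DualProducts.

Context {K : fieldType} {H : hopfAlgType K}.
Implicit Types (p q r : hdual H) (a b c d h k : H).

Local Notation tliftEK := (tliftE (K := K)).
Local Notation tmul_pureK := (tmul_pure (K := K)).

Lemma mul_bilin : bilin (@GRing.mul H).
Proof.
split=> y c u v; first by rewrite mulrDl -scalerAl.
by rewrite mulrDr -scalerAr.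
Qed.

(** This is (p ⊗ q)(s Delta(?) t). Being linear in s and t, it lets the action on a product pq be
    read off once the coproducts of the multipliers are written as sums of pure tensors. *)
Definition dual_act2 p q (s t : tensor H H) : hdual H :=
  linfun (fun a => tlift (fun b c => p b * q c : K^o)
    (tmul *%R *%R (tmul *%R *%R s (comul a)) t) : K^o).

Lemma dual_act2E p q s t a : dual_act2 p q s t a =
  tlift (fun b c => p b * q c : K^o)
    (tmul *%R *%R (tmul *%R *%R s (comul a)) t).
Proof.
rewrite /fun_of_dual linfunE // => c u v.
have [ml mr] := tmul_bilin (@GRing.mul H) (@GRing.mul H).
by rewrite linearP mr ml linearP.
Qed.

Lemma dual_act2_bilin p q : bilin (dual_act2 p q).
Proof.
have [ml mr] := tmul_bilin (@GRing.mul H) (@GRing.mul H).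
split=> y c u v; apply: hdual_eq => a; rewrite hdualE !dual_act2E.
  by rewrite !ml linearP.
by rewrite !mr linearP.
Qed.

Lemma dual_act2_pure p q a b c d :
  dual_act2 p q (a ⊗ b) (c ⊗ d) =
  dual_mul (dual_act a c p) (dual_act b d q).
Proof.
have [ml mr] := tmul_bilin (@GRing.mul H) (@GRing.mul H).
apply: hdual_eq => y; rewrite dual_act2E dual_mulE.
move: (comul y); apply: tensor_lin_eq => [k u v|k u v|u v].
- by rewrite mr ml linearP.
- by rewrite linearP.
rewrite !tmul_pureK; try exact: mul_bilin.
by rewrite !tliftEK ?dual_actE //; apply: hdualM_bilin.
Qed.

Lemma dual_act_mul a b p q :
  dual_act a b (dual_mul p q) = dual_act2 p q (comul a) (comul b).
Proof.
by apply: hdual_eq => y; rewrite dual_actE dual_mulE dual_act2E !comulM.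
Qed.

(** The transpose of [comulM]: both sides, evaluated at a and b, are the sum of p(a_1 b_1) q(a_2
    b_2). *)
Lemma dual_comul_mul p q :
  dual_comul (dual_mul p q) =
  tmul (@dual_mul K H) (@dual_mul K H) (dual_comul p) (dual_comul q).
Proof.
have [ml mr] := tmul_bilin (@GRing.mul H) (@GRing.mul H).
have [dl dr] := tmul_bilin (@dual_mul K H) (@dual_mul K H).
pose ev a b (u : tensor (hdual H) (hdual H)) : K^o :=
  tlift (fun q r : hdual H => q a * r b : K^o) u.
(* [F] is the common value with the coproducts of p, q, a and b replaced by arbitrary tensors, so
   that each can be reduced to pure tensors in turn. *)
pose F (P Q : tensor (hdual H) (hdual H)) (s t : tensor H H) : K^o :=
  tlift (fun a1 a2 => tlift (fun b1 b2 => ev a1 b1 P * ev a2 b2 Q : K^o) t) s.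
have evZ a b : linear (ev a b) by move=> c u v; rewrite /ev linearP.
have bil P Q a1 a2 : bilin (fun b1 b2 => ev a1 b1 P * ev a2 b2 Q : K^o).
  split=> y c u v.
    rewrite -[RHS]/(c * (_ * _) + _) mulrA -mulrDl; congr (_ * _).
    apply: (tlift_linear_param
      (B := fun u (q r : hdual H) => q a1 * r u : K^o)) => q' r' k w z.
    by rewrite (dualP r') mulrDr mulrCA.
  rewrite -[RHS]/(c * (_ * _) + _) mulrCA -mulrDr; congr (_ * _).
  apply: (tlift_linear_param
    (B := fun u (q r : hdual H) => q a2 * r u : K^o)) => q' r' k w z.
  by rewrite (dualP r') mulrDr mulrCA.
have bil2 P Q t : bilin (fun a1 a2 =>
    tlift (fun b1 b2 => ev a1 b1 P * ev a2 b2 Q : K^o) t).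
  split=> y.
    apply: (tlift_linear_param
      (B := fun a1 b1 b2 => ev a1 b1 P * ev y b2 Q : K^o)) => b1 b2 c u v.
    rewrite -[RHS]/(c * (_ * _) + _) mulrA -mulrDl; congr (_ * _).
    apply: (tlift_linear_param
      (B := fun u (q r : hdual H) => q u * r b1 : K^o)) => q' r' k w z.
    by rewrite (dualP q') mulrDl -mulrA.
  apply: (tlift_linear_param
    (B := fun a2 b1 b2 => ev y b1 P * ev a2 b2 Q : K^o)) => b1 b2 c u v.
  rewrite -[RHS]/(c * (_ * _) + _) mulrCA -mulrDr; congr (_ * _).
  apply: (tlift_linear_param
    (B := fun u (q r : hdual H) => q u * r b2 : K^o)) => q' r' k w z.
  by rewrite (dualP q') mulrDl -mulrA.
apply: dual_tensor_eq => a b.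
transitivity (F (dual_comul p) (dual_comul q) (comul a) (comul b)).
  rewrite dual_comulE dual_mulE comulM.
  move: (comul a) => s; move: s (comul b); apply: tensor_ind.
  - by move=> t; rewrite (lin0 (ml _)) /F !linear0.
  - move=> s s' IH IH' t; move: (IH t) (IH' t).
    by rewrite (linD (ml _)) /F !linearD /= => -> ->.
  move=> a1 a2; apply: tensor_lin_eq => [c u v|c u v|b1 b2].
  - by rewrite mr linearP.
  - by rewrite /F !(tliftEK _ _ (bil2 _ _ _)) linearP.
  rewrite tmul_pureK; try exact: mul_bilin.
  rewrite (tliftEK _ _ (hdualM_bilin _ _)) /F (tliftEK _ _ (bil2 _ _ _)).
  by rewrite (tliftEK _ _ (bil _ _ _ _)) /ev !dual_comulE.
have FP Q s t : linear (fun P => F P Q s t).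
  apply: (tlift_linear_param (B := fun P a1 a2 =>
    tlift (fun b1 b2 => ev a1 b1 P * ev a2 b2 Q : K^o) t)) => a1 a2.
  apply: (tlift_linear_param (B := fun P b1 b2 =>
    ev a1 b1 P * ev a2 b2 Q : K^o)) => b1 b2 c u v.
  by rewrite evZ mulrDl -mulrA.
have FQ P s t : linear (fun Q => F P Q s t).
  apply: (tlift_linear_param (B := fun Q a1 a2 =>
    tlift (fun b1 b2 => ev a1 b1 P * ev a2 b2 Q : K^o) t)) => a1 a2.
  apply: (tlift_linear_param (B := fun Q b1 b2 =>
    ev a1 b1 P * ev a2 b2 Q : K^o)) => b1 b2 c u v.
  by rewrite evZ mulrDr mulrCA.
move: (dual_comul q) (dual_comul p) => Q; apply: tensor_lin_eq => [||p1 p2].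
- exact: FP.
- by move=> c u v; rewrite dl linearP.
move: Q; apply: tensor_lin_eq => [||q1 q2].
- exact: FQ.
- by move=> c u v; rewrite dr linearP.
rewrite tmul_pureK; try exact: dual_mul_bilin.
rewrite (tliftEK _ _ (dual_eval_bilin _ _)) !dual_mulE /F.
have mulcl (c : K) : linear (fun y : K^o => y * c : K^o).
  by move=> k u v; rewrite mulrDl -mulrA.
have mulcr (c : K) : linear (fun y : K^o => c * y : K^o).
  by move=> k u v; rewrite mulrDr mulrCA.
rewrite (tlift_comp (K := K) _ _ (mulcl _)); apply: eq_tlift => a1 a2.
rewrite (tlift_comp (K := K) _ _ (mulcr _)); apply: eq_tlift => b1 b2.
by rewrite /ev !(tliftEK _ _ (dual_eval_bilin _ _)) mulrACA.
Qed.

Lemma dual_comul1 :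
  dual_comul (counit : hdual H) = (counit : hdual H) ⊗ (counit : hdual H).
Proof.
apply: dual_tensor_eq => a b.
by rewrite dual_comulE (tliftEK _ _ (dual_eval_bilin _ _)); apply: counitM.
Qed.

End DualProducts.

(** * The Drinfel'd double *)

Section Double.

Context {K : fieldType} {H : hopfAlgType K}.
Implicit Types (p q r : hdual H) (a b c h k : H) (d : drinfeld_double H).

Local Notation D := (drinfeld_double H).
Local Notation S' := (antipode^-1)%VF.
Local Notation tliftEK := (tliftE (K := K)).
Local Notation tmap_pureK := (tmap_pure (K := K)).
Local Notation tmul_pureK := (tmul_pure (K := K)).
Local Notation comul2 h := (tmap comul id (comul h)).

Lemma double_mul_pureE p h q k : double_mul_pure p h q k =
  tlift3 (fun h1 h2 h3 : H =>
    dual_mul p (dual_act (S' h3) h1 q) ⊗ (h2 * k) : D) (comul2 h).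
Proof.
rewrite /double_mul_pure /tlift3; apply: eq_tlift => u h3; apply: eq_tlift => h1 h2.
apply: (tlift3_dual_comul (F := fun r : hdual H => dual_mul p r ⊗ (h2 * k) : D)).
by move=> c r s; rewrite (dual_mul_bilin (H := H)).2 pure_linl.
Qed.

Lemma double_mul_bilin : bilin (@double_mul K H).
Proof.
split=> [d|d]; first exact: linearP.
apply: (tlift_linear_param (B := fun d p h => tlift (double_mul_pure p h) d)).
by move=> p h; exact: linearP.
Qed.

Lemma double_mulE p h q k : (p ⊗ h : D) *D (q ⊗ k) =
  tlift3 (fun h1 h2 h3 : H =>
    dual_mul p (dual_act (S' h3) h1 q) ⊗ (h2 * k) : D) (comul2 h).
Proof.
have [ml mr] := dual_mul_bilin (H := H).
have bil q' k' : bilin (fun p h => double_mul_pure p h q' k').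
  split=> y c u v; rewrite !double_mul_pureE.
    apply: (tlift3_linear_param (B := fun p (h1 h2 h3 : H) =>
      dual_mul p (dual_act (S' h3) h1 q') ⊗ (h2 * k') : D)).
    by move=> a b c' k2 w z; rewrite ml pure_linl.
  by rewrite !linearP.
have bil' p' h' : bilin (double_mul_pure p' h').
  split=> y c u v; rewrite !double_mul_pureE.
    apply: (tlift3_linear_param (B := fun q (h1 h2 h3 : H) =>
      dual_mul p' (dual_act (S' h3) h1 q) ⊗ (h2 * y) : D)).
    by move=> a b c' k2 w z; rewrite dual_act_lin mr pure_linl.
  apply: (tlift3_linear_param (B := fun k (h1 h2 h3 : H) =>
    dual_mul p' (dual_act (S' h3) h1 y) ⊗ (h2 * k) : D)).
  by move=> a b c' k2 w z; rewrite mulrDr -scalerAr pure_linr.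
rewrite /double_mul tliftEK; first by rewrite (tliftEK _ _ (bil' _ _)) double_mul_pureE.
split=> y.
  apply: (tlift_linear_param (B := fun p q k => double_mul_pure p y q k)) => u v.
  exact: (bil u v).1.
apply: (tlift_linear_param (B := fun h q k => double_mul_pure y h q k)) => u v.
exact: (bil u v).2.
Qed.

(** The action of h on the double with the iterated coproduct of h freed to any tensor in H ⊗ H ⊗ H;
    multiplicativity in h then reduces to pure tensors. *)
Definition double_act3 (t : tensor (tensor H H) H) d : D :=
  tlift3 (fun a b c : H => tmap (dual_act (S' c) a) (GRing.mul b) d) t.

Lemma double_act3_bilin : bilin double_act3.
Proof.
split=> y; first exact: linearP.
apply: (tlift3_linear_param (B := fun d (a b c : H) =>
  tmap (dual_act (S' c) a) (GRing.mul b) d)) => u v w.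
exact: linearP.
Qed.

Lemma mull_lin b : linear (GRing.mul b).
Proof. exact: (mul_bilin (H := H)).2. Qed.

Lemma double_act3_pure a b c d :
  double_act3 (a ⊗ b ⊗ c) d = tmap (dual_act (S' c) a) (GRing.mul b) d.
Proof.
have bil c' d' : bilin (fun a b => tmap (dual_act (S' c') a) (GRing.mul b) d' : D).
  split=> y k u v.
    apply: (tlift_linear_param
      (B := fun a p (h : H) => dual_act (S' c') a p ⊗ (y * h))).
    by move=> p h k' a1 a2; rewrite (dual_act_bilin _).2 pure_linl.
  apply: (tlift_linear_param
    (B := fun b p (h : H) => dual_act (S' c') y p ⊗ (b * h))).
  by move=> p h k' a1 a2; rewrite mulrDl -scalerAl pure_linr.
rewrite /double_act3 /tlift3 tliftEK; first exact: (tliftEK _ _ (bil _ _)).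
split=> y; first exact: linearP.
apply: (tlift_linear_param
  (B := fun c' a b => tmap (dual_act (S' c') a) (GRing.mul b) d : D)).
move=> a' b'.
apply: (tlift_linear_param
  (B := fun c' p (h : H) => dual_act (S' c') a' p ⊗ (b' * h))).
by move=> p h k' a1 a2; rewrite linearP (dual_act_bilin _).1 pure_linl.
Qed.

Lemma double_in_mulE h d : double_in h *D d = double_act3 (comul2 h) d.
Proof.
have [ml mr] := double_mul_bilin; have [al ar] := double_act3_bilin.
move: d; apply: tensor_lin_eq => [||q k].
- exact: mr.
- exact: ar.
rewrite /double_in double_mulE /double_act3; apply: eq_tlift3 => a b c.
by rewrite dual_mul1p tmap_pureK //; [exact: dual_act_lin|exact: mull_lin].
Qed.

Hypothesis S_inj : lker (@antipode K H) == 0%VS.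
Hypothesis SM : forall a b, antipode (a * b) = antipode b * antipode a :> H.

Lemma antipode1 : antipode 1 = 1 :> H.
Proof.
have := antipodel (1 : H); rewrite comul1 counit1 scale1r.
rewrite tliftEK ?mulr1 //; split=> y c u v.
  by rewrite linearP mulrDl -scalerAl.
by rewrite mulrDr -scalerAr.
Qed.

Lemma antipodeVK : cancel (@antipode K H) S'.
Proof. exact: lker0_lfunK. Qed.

Lemma antipodeKV : cancel S' (@antipode K H).
Proof. exact: lker0_lfunVK. Qed.

Lemma antipodeV1 : S' 1 = 1 :> H.
Proof. by rewrite -{1}antipode1 antipodeVK. Qed.

Lemma antipodeVM a b : S' (a * b) = S' b * S' a :> H.
Proof. by rewrite -{1}[a]antipodeKV -{1}[b]antipodeKV -SM antipodeVK. Qed.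

(** In the product formula p enters only as a left factor of the functional part, so p ⊗ h acts as h
    followed by left multiplication by p. *)
Lemma double_splitE p h d :
  (p ⊗ h : D) *D d = tmap (dual_mul p) id (double_in h *D d).
Proof.
have [ml mr] := double_mul_bilin.
move: d; apply: tensor_lin_eq => [||q k].
- exact: mr.
- by move=> c u v; rewrite mr linearP.
rewrite /double_in !double_mulE.
rewrite (tlift3_comp (f := tmap (dual_mul p) id)); last exact: linearP.
apply: eq_tlift3 => a b c.
by rewrite dual_mul1p tmap_pureK //; exact: (dual_mul_bilin (H := H)).2.
Qed.

Lemma double_mul1 d : double_one H *D d = d.
Proof.
rewrite -[double_one H]/(double_in (1 : H)) double_in_mulE comul1.
rewrite tmap_pureK //; last by move=> c u v; rewrite linearP.
rewrite comul1 double_act3_pure antipodeV1.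
rewrite -[RHS]tmap_id; apply: eq_tlift => p h.
by rewrite dual_act1 mul1r.
Qed.

Lemma double_in_dualE p d : double_in_dual p *D d = tmap (dual_mul p) id d.
Proof. by rewrite double_splitE -/(double_one H) double_mul1. Qed.

Lemma double_in_dual_pure p q k :
  double_in_dual p *D (q ⊗ k : D) = dual_mul p q ⊗ k.
Proof.
by rewrite double_in_dualE tmap_pureK //; exact: (dual_mul_bilin (H := H)).2.
Qed.

Lemma double_splitM p h d :
  (p ⊗ h : D) *D d = double_in_dual p *D (double_in h *D d).
Proof. by rewrite double_splitE double_in_dualE. Qed.

Lemma double_in_dualM p q d :
  double_in_dual p *D (double_in_dual q *D d) = double_in_dual (dual_mul p q) *D d.
Proof.
have [ml mr] := double_mul_bilin.
move: d; apply: tensor_lin_eq => [||r k].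
- by move=> c u v; rewrite !mr.
- exact: mr.
by rewrite !double_in_dual_pure dual_mulA.
Qed.

Lemma comul2M a b : comul2 (a * b) =
  tmul (tmul *%R *%R) *%R (comul2 a) (comul2 b) :> tensor (tensor H H) H.
Proof.
rewrite comulM; move: (comul a) (comul b) => s t.
have bilH := mul_bilin (H := H).
have [ml mr] := tmul_bilin (@GRing.mul H) (@GRing.mul H).
have bilHH := tmul_bilin (@GRing.mul H) (@GRing.mul H).
have [nl nr] := tmul_bilin (tmul (@GRing.mul H) (@GRing.mul H)) (@GRing.mul H).
have lc : linear (@comul K H) by exact: linearP.
move: s; apply: tensor_lin_eq => [c u v|c u v|a1 a2].
- by rewrite ml linearP.
- by rewrite linearP nl.
move: t; apply: tensor_lin_eq => [c u v|c u v|b1 b2].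
- by rewrite mr linearP.
- by rewrite linearP nr.
by rewrite tmul_pureK // !tmap_pureK // comulM tmul_pureK.
Qed.

(** On pure tensors the reversal in [dual_act_comp] and the one in [antipodeVM] cancel. *)
Lemma double_act3M s t d :
  double_act3 (tmul (tmul *%R *%R) *%R s t) d = double_act3 s (double_act3 t d).
Proof.
have bilH := mul_bilin (H := H).
have [ml mr] := tmul_bilin (@GRing.mul H) (@GRing.mul H).
have bilHH := tmul_bilin (@GRing.mul H) (@GRing.mul H).
have [nl nr] := tmul_bilin (tmul (@GRing.mul H) (@GRing.mul H)) (@GRing.mul H).
have [al ar] := double_act3_bilin.
move: s; apply: tensor_lin_eq => [c u v|c u v|s a3].
- by rewrite nl al.
- by rewrite al.
move: s; apply: tensor_lin_eq => [c u v|c u v|a1 a2].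
- by rewrite pure_linl nl al.
- by rewrite pure_linl al.
move: t; apply: tensor_lin_eq => [c u v|c u v|t b3].
- by rewrite nr al.
- by rewrite al ar.
move: t; apply: tensor_lin_eq => [c u v|c u v|b1 b2].
- by rewrite pure_linl nr al.
- by rewrite pure_linl al ar.
rewrite !tmul_pureK // !double_act3_pure.
move: d; apply: tensor_lin_eq => [c u v|c u v|p k].
- by rewrite linearP.
- by rewrite !linearP.
have lm := mull_lin; have ld := dual_act_lin (H := H).
by rewrite !tmap_pureK // dual_act_comp antipodeVM mulrA.
Qed.

Lemma double_inM a b d :
  double_in a *D (double_in b *D d) = double_in (a * b) *D d.
Proof. by rewrite !double_in_mulE comul2M double_act3M. Qed.

End Double.

(** * The double of a Hopf algebra generated by a group-like and a skew-primitive element *)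

Section SkewPrimitive.

Context {K : fieldType} {H : hopfAlgType K}.
Implicit Types (p q r : hdual H) (a b c h k : H) (d : drinfeld_double H).

Local Notation D := (drinfeld_double H).
Local Notation S' := (antipode^-1)%VF.
Local Notation tliftEK := (tliftE (K := K)).
Local Notation tmap_pureK := (tmap_pure (K := K)).
Local Notation tmul_pureK := (tmul_pure (K := K)).

Hypothesis S_inj : lker (@antipode K H) == 0%VS.
Hypothesis SM : forall a b, antipode (a * b) = antipode b * antipode a :> H.

Variables g gi x : H.
Hypothesis giK : gi * g = 1.
Hypothesis gKi : g * gi = 1.
Hypothesis comul_g : comul g = g ⊗ g.
Hypothesis comul_x : comul x = g ⊗ x + x ⊗ 1.

(** The counit axiom says that counit(g) g = g; multiplying by the inverse of g turns this into an
    equation between scalar multiples of 1. *)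
Lemma counit_g : counit g = 1 :> K^o.
Proof.
have := counitl g; rewrite comul_g tliftEK => [e|].
  have : (counit g - 1 : K) *: (g * gi : H) = 0.
    by rewrite scalerAl scalerBl e scale1r subrr mul0r.
  by rewrite gKi => /eqP; rewrite scaler_eq0 oner_eq0 orbF subr_eq0 => /eqP.
split=> y c u v; first by rewrite linearP scalerDl scalerA.
by rewrite scalerDr !scalerA mulrC.
Qed.

Lemma counit_gi : counit gi = 1 :> K^o.
Proof. by rewrite -[LHS]mul1r -[X in X * _]counit_g -counitM gKi counit1. Qed.

Lemma counit_x : counit x = 0 :> K^o.
Proof.
have bil : bilin (fun a b => (counit b : K) *: a : H).
  split=> y c u v; last by rewrite linearP scalerDl scalerA.
  by rewrite scalerDr !scalerA mulrC.
have := counitr x; rewrite comul_x linearD /= !(tliftEK _ _ bil).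
rewrite counit1 scale1r => e; have : (counit x : K) *: (g * gi : H) = 0.
  rewrite scalerAl (_ : (counit x : K) *: (g : H) = 0) ?mul0r //.
  by apply: (addIr x); rewrite e add0r.
by rewrite gKi => /eqP; rewrite scaler_eq0 oner_eq0 orbF => /eqP.
Qed.

Lemma antipodel_bilin : bilin (fun a b => antipode a * b : H).
Proof.
split=> y c u v; first by rewrite linearP mulrDl -scalerAl.
by rewrite mulrDr -scalerAr.
Qed.

Lemma antipode_g : antipode g = gi.
Proof.
have := antipodel g; rewrite comul_g (tliftEK _ _ antipodel_bilin) counit_g.
by rewrite scale1r => e; rewrite -[LHS]mulr1 -gKi mulrA e mul1r.
Qed.

Lemma antipode_x : antipode x = - (gi * x).
Proof.
have := antipodel x; rewrite comul_x linearD /= !(tliftEK _ _ antipodel_bilin).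
rewrite counit_x scale0r mulr1 antipode_g => e.
by apply: (addrI (gi * x)); rewrite e subrr.
Qed.

Lemma antipodeV_g : S' g = gi :> H.
Proof.
have e : antipode gi = g.
  have := SM gi g; rewrite giK antipode1 antipode_g => e.
  by rewrite -[LHS]mul1r -gKi -mulrA -e mulr1.
by rewrite -e (antipodeVK S_inj).
Qed.

Lemma antipodeV_x : S' x = - (x * gi) :> H.
Proof.
have e : antipode gi = g by rewrite -antipodeV_g (antipodeKV S_inj).
apply: (can_inj (antipodeVK S_inj)); rewrite (antipodeKV S_inj).
by rewrite linearN /= SM e antipode_x mulrN opprK mulrA gKi mul1r.
Qed.

Lemma double_in_gE d :
  double_in g *D d = tmap (dual_act gi g) (GRing.mul g) d.
Proof.
rewrite double_in_mulE comul_g tmap_pureK //; last by move=> c u v; rewrite linearP.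
by rewrite comul_g double_act3_pure antipodeV_g.
Qed.

(** One summand for each term of the iterated coproduct of x; the first carries S^-1(x) = -(x
    g^-1). *)
Lemma double_in_xE d :
  double_in x *D d = tmap (dual_act (- (x * gi)) g) (GRing.mul g) d
    + tmap (dual_act 1 g) (GRing.mul x) d + tmap (dual_act 1 x) id d.
Proof.
have lc : linear (@comul K H) by move=> c u v; rewrite linearP.
have [al _] := double_act3_bilin (H := H).
rewrite double_in_mulE comul_x linearD /= !tmap_pureK // comul_g comul_x.
rewrite (linD (pure_linl _)) !(linD (al _)) !double_act3_pure.
rewrite antipodeV_x (antipodeV1 S_inj) addrA; congr (_ + _ + _).
by apply: eq_tlift => p h; rewrite mul1r.
Qed.

Let lm := mull_lin (H := H).
Let ld := dual_act_lin (H := H).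

Lemma double_in_g_pure q k :
  double_in g *D (q ⊗ k : D) = dual_act gi g q ⊗ (g * k).
Proof. by rewrite double_in_gE tmap_pureK. Qed.

Lemma double_in_x_pure q k :
  double_in x *D (q ⊗ k : D) = dual_act (- (x * gi)) g q ⊗ (g * k)
    + dual_act 1 g q ⊗ (x * k) + dual_act 1 x q ⊗ k.
Proof. by rewrite double_in_xE !tmap_pureK. Qed.

Definition lassoc d : Prop := forall b c : D, d *D (b *D c) = (d *D b) *D c.

Lemma lassoc_lin (c : K) d d' : lassoc d -> lassoc d' -> lassoc (c *: d + d').
Proof.
have [ml mr] := double_mul_bilin (H := H).
by move=> dP d'P u v; rewrite !ml dP d'P.
Qed.

Lemma lassocM d d' : lassoc d -> lassoc d' -> lassoc (d *D d').
Proof. by move=> dP d'P u v; rewrite -dP d'P dP -[in RHS]dP. Qed.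

Lemma lassoc_dual p : lassoc (double_in_dual p).
Proof.
have [ml mr] := double_mul_bilin (H := H).
move=> b c; move: b; apply: tensor_lin_eq => [k u v|k u v|q h].
- by rewrite ml mr.
- by rewrite mr ml.
rewrite (double_in_dual_pure S_inj) (double_splitM S_inj q h).
by rewrite (double_splitM S_inj (dual_mul p q) h) (double_in_dualM S_inj).
Qed.

Lemma double_mul_inr r a h d :
  (r ⊗ a : D) *D (double_in h *D d) = (r ⊗ (a * h) : D) *D d.
Proof.
rewrite (double_splitM S_inj r a) (double_splitM S_inj r (a * h)).
by rewrite (double_inM S_inj SM).
Qed.

(** Both sides are inverse to Delta(g) = g ⊗ g in the algebra H ⊗ H. *)
Lemma comul_gi : comul gi = gi ⊗ gi.
Proof.
have bilH := mul_bilin (H := H).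
have bilHH := tmul_bilin (@GRing.mul H) (@GRing.mul H).
have assH : associative (tmul (@GRing.mul H) (@GRing.mul H)).
  by apply: tmulA => //; exact: mulrA.
have one (t : tensor H H) : tmul *%R *%R t (1 ⊗ 1) = t.
  move: t; apply: tensor_lin_eq => [|//|a b]; first exact: bilHH.1.
  by rewrite tmul_pureK // !mulr1.
rewrite -[LHS]one -{1}gKi -[X in _ ⊗ X]gKi -(tmul_pureK) // assH -comul_g -comulM.
by rewrite giK comul1 tmul_pureK // !mul1r.
Qed.

Lemma dual_act_g p q :
  dual_act gi g (dual_mul p q) = dual_mul (dual_act gi g p) (dual_act gi g q).
Proof. by rewrite dual_act_mul comul_g comul_gi dual_act2_pure. Qed.

Lemma dual_act_1g p q :
  dual_act 1 g (dual_mul p q) = dual_mul (dual_act 1 g p) (dual_act 1 g q).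
Proof. by rewrite dual_act_mul comul_g comul1 dual_act2_pure. Qed.

(** Skew-primitivity of x makes p(? x) a skew derivation twisted by p(? g); [dual_act_xg] is the
    analogue for S^-1(x), whose coproduct is [comul_xgi]. *)
Lemma dual_act_1x p q : dual_act 1 x (dual_mul p q) =
  dual_mul (dual_act 1 g p) (dual_act 1 x q) + dual_mul (dual_act 1 x p) q.
Proof.
have [_ ar] := dual_act2_bilin p q.
by rewrite dual_act_mul comul_x comul1 (linD (ar _)) !dual_act2_pure dual_act1.
Qed.

Lemma comul_xgi :
  comul (- (x * gi)) = 1 ⊗ (- (x * gi)) + (- (x * gi)) ⊗ gi.
Proof.
have [ml _] := tmul_bilin (@GRing.mul H) (@GRing.mul H).
have bilH := mul_bilin (H := H).
rewrite linearN /= comulM comul_x comul_gi (linD (ml _)) !tmul_pureK //.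
by rewrite gKi mul1r (linN (pure_linl _)) (linN (pure_linr _)) opprD.
Qed.

Lemma dual_act_xg p q : dual_act (- (x * gi)) g (dual_mul p q) =
  dual_mul (dual_act 1 g p) (dual_act (- (x * gi)) g q)
  + dual_mul (dual_act (- (x * gi)) g p) (dual_act gi g q).
Proof.
have [al _] := dual_act2_bilin p q.
by rewrite dual_act_mul comul_xgi comul_g (linD (al _)) !dual_act2_pure.
Qed.

Lemma double_in_g_dualM q d :
  double_in g *D (double_in_dual q *D d) =
  (double_in g *D double_in_dual q) *D d.
Proof.
have [ml mr] := double_mul_bilin (H := H).
move: d; apply: tensor_lin_eq => [c u v||r k]; [by rewrite !mr|exact: mr|].
rewrite (double_in_dual_pure S_inj) !double_in_g_pure mulr1 (double_splitM S_inj).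
by rewrite double_in_g_pure (double_in_dual_pure S_inj) dual_act_g.
Qed.

(** Expanding by the skew-derivation rules gives five terms on each side. On the right the cross
    terms arise because the summand q(? g) ⊗ x of xq acts on d through three terms again. *)
Lemma double_in_x_dualM q d :
  double_in x *D (double_in_dual q *D d) =
  (double_in x *D double_in_dual q) *D d.
Proof.
have [ml mr] := double_mul_bilin (H := H).
move: d; apply: tensor_lin_eq => [c u v||r k]; [by rewrite !mr|exact: mr|].
rewrite (double_in_dual_pure S_inj) !double_in_x_pure !mulr1 !(linD (ml _)).
rewrite (double_splitM S_inj _ g) (double_splitM S_inj _ x).
rewrite double_in_x_pure double_in_g_pure !(linD (mr _)).
rewrite !(double_in_dual_pure S_inj) dual_act_xg dual_act_1g dual_act_1x.
by rewrite !(linD (pure_linl _)) [X in X + _ + _]addrC -!addrA.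
Qed.

Lemma lassoc_g : lassoc (double_in g).
Proof.
have [ml mr] := double_mul_bilin (H := H).
move=> b c; move: b; apply: tensor_lin_eq => [k u v|k u v|q h].
- by rewrite ml mr.
- by rewrite mr ml.
rewrite (double_splitM S_inj q h) double_in_g_dualM !double_in_g_pure.
by rewrite double_mul_inr mulr1.
Qed.

Lemma lassoc_x : lassoc (double_in x).
Proof.
have [ml mr] := double_mul_bilin (H := H).
move=> b c; move: b; apply: tensor_lin_eq => [k u v|k u v|q h].
- by rewrite ml mr.
- by rewrite mr ml.
rewrite (double_splitM S_inj q h) double_in_x_dualM !double_in_x_pure.
by rewrite !(linD (ml _)) !double_mul_inr !mulr1 mul1r.
Qed.

Hypothesis H_ind : forall P : H -> Prop,
  (forall (c : K) a b, P a -> P b -> P (c *: a + b)) -> P 1 ->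
  (forall a, P a -> P (g * a)) -> (forall a, P a -> P (x * a)) -> forall a, P a.

Lemma dual_act_counit a b :
  dual_act a b (counit : hdual H) = (counit a * counit b : K) *: (counit : hdual H).
Proof.
by apply: hdual_eq => h; rewrite dual_actE hdualZE /fun_of_dual !counitM mulrAC.
Qed.

Lemma double_in_gM h : double_in g *D double_in h = double_in (g * h).
Proof.
by rewrite double_in_g_pure dual_act_counit counit_gi counit_g mul1r scale1r.
Qed.

Lemma double_in_xM h : double_in x *D double_in h = double_in (x * h).
Proof.
rewrite double_in_x_pure !dual_act_counit linearN /= counitM counit1 counit_g.
rewrite counit_x !mul1r mul0r oppr0 mul0r !scale0r scale1r.
by rewrite !(lin0 (pure_linl _)) addr0 add0r.
Qed.

(** A pure tensor p ⊗ h is the product of p and h, and h is built from 1 by left multiplications by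
    g and x, which [double_in] respects. *)
Lemma double_ind (P : D -> Prop) :
    (forall (c : K) (u v : D), P u -> P v -> P (c *: u + v)) ->
    (forall u v : D, P u -> P v -> P (u *D v)) ->
    (forall p, P (double_in_dual p)) -> P (double_in g) -> P (double_in x) ->
  forall d, P d.
Proof.
move=> Plin PM Pdual Pg Px.
have P1 : P (double_one H) by exact: Pdual.
have P0 : P 0 by have := Plin (-1) _ _ P1 P1; rewrite scaleN1r addNr.
have PD (u v : D) : P u -> P v -> P (u + v).
  by move=> Pu Pv; rewrite -[u]scale1r; apply: Plin.
have Pin h : P (double_in h).
  move: h; apply: H_ind => [c a b Pa Pb||a Pa|a Pa].
  - by rewrite /double_in pure_linr; apply: Plin.
  - exact: P1.
  - by rewrite -double_in_gM; apply: PM.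
  - by rewrite -double_in_xM; apply: PM.
apply: tensor_ind => // p h; rewrite -[p]dual_mulp1 -(double_in_dual_pure S_inj).
by apply: PM => //; apply: Pin.
Qed.

Lemma double_mulA : associative (@double_mul K H).
Proof.
apply: double_ind; [exact: lassoc_lin|exact: lassocM|exact: lassoc_dual| |].
  exact: lassoc_g.
exact: lassoc_x.
Qed.

Lemma double_mulr1 d : d *D double_one H = d.
Proof.
have [ml mr] := double_mul_bilin (H := H).
move: d; apply: double_ind => [c u v|u v eu ev|p||].
- by rewrite ml => -> ->.
- by rewrite -double_mulA ev.
- by rewrite (double_in_dual_pure S_inj) dual_mulp1.
- by rewrite double_in_gM mulr1.
- by rewrite double_in_xM mulr1.
Qed.

(** [double_comul] with the coproducts of the functional and of the element freed to arbitrary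
    tensors; the functional legs are crossed. *)
Definition double_comul2 (u : tensor (hdual H) (hdual H)) (t : tensor H H) :
    tensor D D :=
  tlift (fun p1 p2 : hdual H => tlift (fun h1 h2 : H =>
    (p2 ⊗ h1 : D) ⊗ (p1 ⊗ h2 : D)) t) u.

Lemma double_comul2_bilin : bilin double_comul2.
Proof.
split=> y; first exact: linearP.
apply: (tlift_linear_param (B := fun t (p1 p2 : hdual H) => tlift (fun h1 h2 : H =>
    (p2 ⊗ h1 : D) ⊗ (p1 ⊗ h2 : D)) t)) => p1 p2.
exact: linearP.
Qed.

Lemma double_comul2_pure p1 p2 h1 h2 :
  double_comul2 (p1 ⊗ p2) (h1 ⊗ h2) = (p2 ⊗ h1 : D) ⊗ (p1 ⊗ h2 : D).
Proof.
rewrite /double_comul2 tliftEK.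
  by rewrite tliftEK //; split=> y c u v; rewrite !(pure_linl, pure_linr).
split=> y.
  apply: (tlift_linear_param (B := fun (p1 : hdual H) (h1 h2 : H) =>
    (y ⊗ h1 : D) ⊗ (p1 ⊗ h2 : D))) => a b c u v.
  by rewrite pure_linl pure_linr.
apply: (tlift_linear_param (B := fun (p1 : hdual H) (h1 h2 : H) =>
  (p1 ⊗ h1 : D) ⊗ (y ⊗ h2 : D))) => a b c u v.
by rewrite !pure_linl.
Qed.

Lemma double_comulE p h :
  double_comul H (p ⊗ h : D) = double_comul2 (dual_comul p) (comul h).
Proof.
have [cl cr] := double_comul2_bilin.
have lc := dual_comul_lin (H := H).
rewrite /double_comul tliftEK //; split=> y c u v.
  by rewrite lc; exact: cl.
by rewrite linearP; exact: cr.
Qed.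

Local Notation tm := (tmul (@double_mul K H) (@double_mul K H)).

Lemma double_comul_in_dual p :
  double_comul H (double_in_dual p) = double_comul2 (dual_comul p) (1 ⊗ 1).
Proof. by rewrite double_comulE comul1. Qed.

Lemma double_comul_in h :
  double_comul H (double_in h) =
  double_comul2 ((counit : hdual H) ⊗ (counit : hdual H)) (comul h).
Proof. by rewrite double_comulE dual_comul1. Qed.

Lemma double_comul_g :
  double_comul H (double_in g) = (double_in g : D) ⊗ (double_in g : D).
Proof. by rewrite double_comul_in comul_g double_comul2_pure. Qed.

Lemma double_comul_x : double_comul H (double_in x) =
  (double_in g : D) ⊗ (double_in x : D) + (double_in x : D) ⊗ (double_one H : D).
Proof.
have [cl cr] := double_comul2_bilin.
by rewrite double_comul_in comul_x (linD (cr _)) !double_comul2_pure.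
Qed.

Let bilD := double_mul_bilin (H := H).
Let bilDD := tmul_bilin (@double_mul K H) (@double_mul K H).
Let bilHH := tmul_bilin (@GRing.mul H) (@GRing.mul H).
Let bilH := mul_bilin (H := H).

Lemma double_comul2_dual u v t :
  tm (double_comul2 u (1 ⊗ 1)) (double_comul2 v t) =
  double_comul2 (tmul (@dual_mul K H) (@dual_mul K H) u v) t.
Proof.
have [cl cr] := double_comul2_bilin.
have [ml mr] := bilDD.
have [nl nr] := tmul_bilin (@dual_mul K H) (@dual_mul K H).
move: u; apply: tensor_lin_eq => [c u w|c u w|p1 p2].
- by rewrite cl ml.
- by rewrite nl cl.
move: v; apply: tensor_lin_eq => [c u w|c u w|q1 q2].
- by rewrite cl mr.
- by rewrite nr cl.
move: t; apply: tensor_lin_eq => [c u w|c u w|h1 h2].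
- by rewrite cr mr.
- by rewrite cr.
rewrite tmul_pureK; try exact: dual_mul_bilin.
rewrite !double_comul2_pure tmul_pureK //.
by rewrite !(double_in_dual_pure S_inj).
Qed.

Lemma double_comul2_g u t :
  tm ((double_in g : D) ⊗ (double_in g : D)) (double_comul2 u t) =
  double_comul2 (tmap (dual_act gi g) (dual_act gi g) u) (tmul *%R *%R (g ⊗ g) t).
Proof.
have [cl cr] := double_comul2_bilin.
have [ml mr] := bilDD.
have [nl nr] := bilHH.
move: u; apply: tensor_lin_eq => [c u w|c u w|p1 p2].
- by rewrite cl mr.
- by rewrite linearP cl.
move: t; apply: tensor_lin_eq => [c u w|c u w|h1 h2].
- by rewrite cr mr.
- by rewrite nr cr.
rewrite tmap_pureK // tmul_pureK // !double_comul2_pure tmul_pureK //.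
by rewrite !double_in_g_pure.
Qed.

(** Three terms come from x acting on the second factor and three from x acting on the first. As the
    functional legs are crossed, the former change the first leg of u. *)
Lemma double_comul2_x u t :
  tm ((double_in g : D) ⊗ (double_in x : D)
      + (double_in x : D) ⊗ (double_one H : D)) (double_comul2 u t) =
    double_comul2 (tmap (dual_act (- (x * gi)) g) (dual_act gi g) u)
      (tmul *%R *%R (g ⊗ g) t)
  + double_comul2 (tmap (dual_act 1 g) (dual_act gi g) u)
      (tmul *%R *%R (g ⊗ x) t)
  + double_comul2 (tmap (dual_act 1 x) (dual_act gi g) u)
      (tmul *%R *%R (g ⊗ 1) t)
  + (double_comul2 (tmap (dual_act 1 1) (dual_act (- (x * gi)) g) u)
      (tmul *%R *%R (g ⊗ 1) t)
  + double_comul2 (tmap (dual_act 1 1) (dual_act 1 g) u)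
      (tmul *%R *%R (x ⊗ 1) t)
  + double_comul2 (tmap (dual_act 1 1) (dual_act 1 x) u)
      (tmul *%R *%R (1 ⊗ 1) t)).
Proof.
have [cl cr] := double_comul2_bilin.
have [ml mr] := bilDD.
have [nl nr] := bilHH.
have addP (V : lmodType K) (c : K) (a b a' b' : V) :
  c *: a + a' + (c *: b + b') = c *: (a + b) + (a' + b').
  by rewrite scalerDr addrACA.
move: u; apply: tensor_lin_eq => [c u w|c u w|p1 p2].
- by rewrite cl mr.
- by rewrite !linearP !cl !addP.
move: t; apply: tensor_lin_eq => [c u w|c u w|h1 h2].
- by rewrite cr mr.
- by rewrite !nr !cr !addP.
rewrite !tmap_pureK // !tmul_pureK // !double_comul2_pure (linD (ml _)).
rewrite !tmul_pureK // !double_in_g_pure !double_in_x_pure (double_mul1 S_inj).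
rewrite !dual_act1 !mul1r !(linD (pure_linl _)) !(linD (pure_linr _)).
by [].
Qed.

Let one_tmul t : tmul *%R *%R (1 ⊗ 1) t = t :> tensor H H.
Proof.
move: t; apply: tensor_lin_eq => [||a b]; [exact: bilHH.2|by []|].
by rewrite tmul_pureK // !mul1r.
Qed.

Let tmap_actN b c u :
  tmap (dual_act 1 (- b)) (dual_act 1 c) u = - tmap (dual_act 1 b) (dual_act 1 c) u.
Proof.
apply: (linN (f := fun b => tmap (dual_act 1 b) (dual_act 1 c) u)).
apply: (tlift_linear_param (B := fun b p q => dual_act 1 b p ⊗ dual_act 1 c q)).
by move=> p r k a a'; rewrite (dual_act_bilin _).2 pure_linl.
Qed.

Lemma double_comulM : {morph double_comul H : a b / a *D b >-> tm a b}.
Proof.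
have [cl cr] := double_comul2_bilin.
have [ml mr] := bilDD.
have [nl nr] := bilHH.
have [dl dr] := bilD.
have ass : associative tm by apply: tmulA => //; exact: double_mulA.
apply: double_ind => [c u v eu ev b|u v eu ev b|p||].
- by rewrite dl !linearP /= ml eu ev.
- by rewrite -(double_mulA u v b) eu ev ass -eu.
- apply: tensor_lin_eq => [c u v|c u v|q h].
  + by rewrite dr linearP.
  + by rewrite linearP mr.
  rewrite (double_in_dual_pure S_inj) !double_comulE comul1 double_comul2_dual.
  by rewrite dual_comul_mul.
- apply: tensor_lin_eq => [c u v|c u v|q h].
  + by rewrite dr linearP.
  + by rewrite linearP mr.
  rewrite double_in_g_pure double_comul_g !double_comulE double_comul2_g.
  by rewrite comulM comul_g dual_comul_act (tmap_dual_act gi g gi g) gKi.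
apply: tensor_lin_eq => [c u v|c u v|q h].
- by rewrite dr linearP.
- by rewrite linearP mr.
rewrite double_in_x_pure double_comul_x !linearD /= !double_comulE double_comul2_x.
(* The multipliers between the two legs are collected in the first leg, where g meets its
   inverse. *)
rewrite (tmap_dual_act (- (x * gi)) g gi g) (tmap_dual_act 1 g gi g) gKi.
rewrite (tmap_dual_act 1 x gi g) (tmap_dual_act 1 1 (- (x * gi))) mul1r tmap_actN.
rewrite !dual_comul_act (linN (cl _)) !comulM comul_g comul_x.
rewrite (linD (nl _)) (linD (cr _)) one_tmul.
(* The terms in which x g^-1 falls between the two arguments of q cancel. *)
have addid (V : zmodType) (a b c d y : V) :
    a + (b + c) + d = a + b + y + (- y + c + d).
  by rewrite !addrA addrK.
by rewrite -addid.
Qed.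

Lemma double_counitE p h :
  double_counit H (p ⊗ h : D) = p 1 * counit h.
Proof.
rewrite /double_counit tliftEK //; split=> y c u v.
  by rewrite hdualE mulrDl -mulrA.
by rewrite linearP mulrDr mulrCA.
Qed.

Lemma double_counitM : {morph double_counit H : a b / a *D b >-> a * b : K^o}.
Proof.
have [dl dr] := bilD.
have linl d : linear (fun b : D => double_counit H d * double_counit H b : K^o).
  by move=> k u v; rewrite linearP mulrDr mulrCA.
apply: double_ind => [c u v eu ev b|u v eu ev b|p||].
- by rewrite dl !linearP /= eu ev mulrDl -mulrA.
- by rewrite -(double_mulA u v b) !eu ev mulrA.
- apply: tensor_lin_eq => [c u v|c u v|q h].
  + by rewrite dr linearP.
  + exact: linl.
  rewrite (double_in_dual_pure S_inj) !double_counitE counit1 mulr1 mulrA.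
  by rewrite dual_mulE comul1 (tliftEK _ _ (hdualM_bilin _ _)).
- apply: tensor_lin_eq => [c u v|c u v|q h].
  + by rewrite dr linearP.
  + exact: linl.
  rewrite double_in_g_pure !double_counitE dual_actE mulr1 giK counitM counit_g.
  by rewrite /fun_of_dual counit1 !mul1r.
apply: tensor_lin_eq => [c u v|c u v|q h].
- by rewrite dr linearP.
- exact: linl.
(* The middle summand vanishes with counit(x) = 0. Up to the factor counit(h), the outer two are
   -q(x) and q(x), as x g^-1 g = x. *)
rewrite double_in_x_pure !linearD /= !double_counitE !dual_actE !counitM counit_g.
rewrite counit_x !mulr1 mul0r !mulr0 mul0r !mul1r addr0 mulNr -mulrA giK mulr1.
by rewrite -mulrDl (linN (dualP _)) addNr mul0r.
Qed.

End SkewPrimitive.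

Section Presentation.

Context {K : fieldType} {A : lmodType K} {mul : A -> A -> A} {one : A} {n : nat}.
Context {s : n.-tuple A} {E : seq (free_alg K n * free_alg K n)}.

Lemma presented_rel (phi : free_alg K n -> A) :
  linear phi -> (forall p, phi p = 0 <-> ideal_gen E p) ->
  forall i, (i < size E)%N -> phi (nth (0, 0) E i).1 = phi (nth (0, 0) E i).2.
Proof.
move=> lphi ker i iE; apply/eqP; rewrite -subr_eq0 -(linB lphi); apply/eqP/ker.
exact/IdealGen/mem_nth.
Qed.

End Presentation.

(** * The Hopf algebra T(4,2,1) *)

Section T421.

Context {K : fieldType} {T : hopfAlgType K} {g x : T}.
Hypothesis TP : is_T421 g x.

Local Notation gi := (g ^+ 3).
Local Notation tliftEK := (tliftE (K := K)).
Local Notation tmul_pureK := (tmul_pure (K := K)).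

Lemma T_comul_g : comul g = g ⊗ g. Proof. by case: TP. Qed.
Lemma T_comul_x : comul x = g ⊗ x + x ⊗ 1. Proof. by case: TP. Qed.

Lemma T_relations : [/\ g ^+ 4 = 1, x * x = g * g - 1 & g * x = - (x * g)].
Proof.
case: TP => [[phi [[lphi phi1 phiM] phis _ ker]] _ _ _].
have rel := presented_rel lphi ker.
have phiX p k : phi (p ^+ k) = phi p ^+ k.
  by elim: k => [|k IH]; rewrite ?expr0 // !exprS phiM IH.
have := rel 0%N isT; have := rel 1%N isT; have := rel 2%N isT.
move: (phis 0) (phis 1); move: (fvar K 0) (fvar K 1) => g' x' /= eg ex r2 r1 r0.
have {eg ex} [<- <-] : phi g' = g /\ phi x' = x by rewrite eg ex.
split.
- by rewrite -phiX -phi1.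
- by rewrite -!phiM -phi1 -(linB lphi) -!expr2.
- by rewrite -!phiM -(linN lphi).
Qed.

Lemma T_g4 : g ^+ 4 = 1. Proof. by case: T_relations. Qed.
Lemma T_xx : x * x = g * g - 1. Proof. by case: T_relations. Qed.
Lemma T_gx : g * x = - (x * g). Proof. by case: T_relations. Qed.

Lemma T_giK : gi * g = 1. Proof. by rewrite -exprSr T_g4. Qed.
Lemma T_gKi : g * gi = 1. Proof. by rewrite -exprS T_g4. Qed.

Lemma T_gx_exp l : g ^+ l * x = (-1) ^+ l *: (x * g ^+ l).
Proof.
elim: l => [|l IH]; first by rewrite !expr0 mulr1 mul1r scale1r.
rewrite exprS -mulrA IH -scalerAr [g * (x * _)]mulrA T_gx exprS.
by rewrite [x * (g * _)]mulrA mulN1r scaleNr mulNr scalerN.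
Qed.

Lemma T_ind (P : T -> Prop) :
    (forall (c : K) a b, P a -> P b -> P (c *: a + b)) -> P 1 ->
    (forall a, P a -> P (g * a)) -> (forall a, P a -> P (x * a)) ->
  forall a, P a.
Proof.
move=> Plin P1 Pg Px a; case: TP => _ _ _ bas.
have P0 : P 0 by have := Plin (-1) _ _ P1 P1; rewrite scaleN1r addNr.
have Pmon k l : P (x ^+ k * g ^+ l).
  elim: k => [|k IH]; last by rewrite exprS -mulrA; apply: Px.
  rewrite expr0 mul1r; elim: l => [|l IH]; first by rewrite expr0.
  by rewrite exprS; apply: Pg.
have := memvf a; rewrite -(eqP (proj1 (andP bas))) => /coord_span ->.
elim/big_ind: _ => // [u v Pu Pv|i _].
  by rewrite -[u]scale1r; apply: Plin.
rewrite -[_ *: _]addr0; apply: Plin => //.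
have iM : (i < size [seq (x ^+ k * g ^+ l)%R | k <- iota 0 2, l <- iota 0 4])%N.
  exact: ltn_ord.
have /allpairsP[[k l] [_ _ ->]] := mem_nth 0 iM; exact: Pmon.
Qed.

Lemma T_lin_eq (V : lmodType K) (f f' : T -> V) : linear f -> linear f' ->
  (forall k l, (k <= 1)%N -> (l <= 3)%N ->
    f (x ^+ k * g ^+ l) = f' (x ^+ k * g ^+ l)) -> f =1 f'.
Proof.
move=> lf lf' ff' a; case: TP => _ _ _ bas.
have := memvf a; rewrite -(eqP (proj1 (andP bas))) => /coord_span ->.
rewrite (lin_sum lf) (lin_sum lf'); apply: eq_bigr => i _.
rewrite (linZ lf) (linZ lf'); congr (_ *: _).
have iM : (i < size [seq (x ^+ k * g ^+ l)%R | k <- iota 0 2, l <- iota 0 4])%N.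
  exact: ltn_ord.
have /allpairsP[[k l] [/= kP lP ->]] := mem_nth 0 iM.
by apply: ff'; [case: (k) kP => [|[|]] | case: (l) lP => [|[|[|[|]]]]].
Qed.

Lemma T_dim : \dim {:T} = 8%N.
Proof.
case: TP => _ _ _ bas.
by rewrite -(eqP (proj1 (andP bas))); have := (proj2 (andP bas)); move=> /eqP ->.
Qed.

Lemma T_grouplike l : comul (g ^+ l) = g ^+ l ⊗ g ^+ l.
Proof.
elim: l => [|l IH]; first by rewrite expr0 comul1.
by rewrite exprS comulM IH T_comul_g tmul_pureK //; exact: mul_bilin.
Qed.

Lemma T_comul_xg l : comul (x * g ^+ l) =
  g ^+ l.+1 ⊗ (x * g ^+ l) + (x * g ^+ l) ⊗ g ^+ l.
Proof.
have [ml _] := tmul_bilin (@GRing.mul T) (@GRing.mul T).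
have bilT := mul_bilin (H := T).
rewrite comulM T_grouplike T_comul_x (linD (ml _)) !tmul_pureK //.
by rewrite mul1r exprS.
Qed.

Lemma T_g_gi_exp l : g ^+ l * gi ^+ l = 1.
Proof. by rewrite -exprM -exprD -mulSn exprM T_g4 expr1n. Qed.

Lemma T_antipode_g l : antipode (g ^+ l) = gi ^+ l.
Proof. exact: (antipode_g (T_g_gi_exp l) (T_grouplike l)). Qed.

Lemma T_counit_g l : counit (g ^+ l) = 1 :> K^o.
Proof. exact: (counit_g (T_g_gi_exp l) (T_grouplike l)). Qed.

Lemma T_counit_x : counit x = 0 :> K^o.
Proof. exact: (counit_x T_gKi T_comul_x). Qed.

Lemma T_antipode_xg l : antipode (x * g ^+ l) = - (gi ^+ l.+1 * x).
Proof.
have bil := antipodel_bilin (H := T).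
have := antipodel (x * g ^+ l); rewrite T_comul_xg linearD /=.
rewrite !(tliftEK _ _ bil) counitM T_counit_x mul0r scale0r T_antipode_g => e.
rewrite -[LHS]mulr1 -[X in _ * X](T_g_gi_exp l) mulrA.
rewrite (_ : antipode (x * g ^+ l) * g ^+ l = - (gi ^+ l.+1 * (x * g ^+ l))).
  by rewrite mulNr -!mulrA T_g_gi_exp mulr1.
by apply: (addrI (gi ^+ l.+1 * (x * g ^+ l))); rewrite e subrr.
Qed.

Lemma T_xgi : x * gi = - (gi * x).
Proof. by rewrite T_gx_exp -[X in X *: _]signr_odd /= expr1 scaleN1r opprK. Qed.

(** Checked on the basis with the explicit values of the antipode. Together with [T_antipode_xM] it
    yields anti-multiplicativity by induction on the left factor. *)
Lemma T_antipode_gM a : antipode (g * a) = antipode a * gi.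
Proof.
move: a; apply: T_lin_eq => [c u v|c u v|k l k1 _].
- by rewrite mulrDr -scalerAr linearP.
- by rewrite linearP mulrDl -scalerAl.
case: k k1 => [|[|//]] _.
  by rewrite expr0 mul1r -exprS !T_antipode_g exprSr.
rewrite expr1 mulrA T_gx mulNr -mulrA -exprS linearN /= !T_antipode_xg opprK.
by rewrite mulNr -[gi ^+ l.+1 * x * gi]mulrA T_xgi mulrN opprK mulrA -exprSr.
Qed.

Lemma T_antipode_x : antipode x = - (gi * x).
Proof. by have := T_antipode_xg 0; rewrite expr0 mulr1 expr1. Qed.

Lemma T_antipode_xM a : antipode (x * a) = antipode a * antipode x.
Proof.
move: a; apply: T_lin_eq => [c u v|c u v|k l k1 _].
- by rewrite mulrDr -scalerAr linearP.
- by rewrite linearP mulrDl -scalerAl.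
rewrite T_antipode_x; case: k k1 => [|[|//]] _.
  by rewrite expr0 mul1r T_antipode_xg T_antipode_g mulrN mulrA -exprSr.
rewrite expr1 mulrA T_xx T_antipode_xg mulrBl mul1r -mulrA -!exprS linearB /=.
rewrite !T_antipode_g mulNr mulrN opprK -mulrA [x * _]mulrA T_xgi mulNr mulrN.
rewrite -[gi * x * x]mulrA T_xx mulrA -exprSr mulrBr mulr1 opprB; congr (_ - _).
rewrite (exprSr gi l.+1) (exprSr gi l) mulrA -[_ * gi * g]mulrA T_giK mulr1.
by rewrite -mulrA T_giK mulr1.
Qed.

Lemma T_antipodeM a b : antipode (a * b) = antipode b * antipode a :> T.
Proof.
move: a b; apply: T_ind => [c u v eu ev b|b|a IH b|a IH b].
- by rewrite mulrDl -scalerAl !linearP /= mulrDr -scalerAr eu ev.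
- by rewrite mul1r antipode1 mulr1.
- by rewrite -mulrA !T_antipode_gM IH mulrA.
- by rewrite -mulrA !T_antipode_xM IH mulrA.
Qed.

(** S^2 fixes g and sends x to -x, so it is an involution; injectivity of S follows. *)
Lemma T_antipode4 (a : T) : antipode (antipode (antipode (antipode a))) = a.
Proof.
have gi3 : gi ^+ 3 = g.
  by rewrite -exprM (exprD g 8 1) (exprM g 4 2) T_g4 expr1n mul1r expr1.
have Sg : antipode (antipode g) = g.
  by have := T_antipode_g 1; rewrite !expr1 => ->; rewrite T_antipode_g.
have Sx : antipode (antipode x) = - x.
  rewrite T_antipode_x linearN /= T_antipodeM T_antipode_x T_antipode_g gi3.
  by rewrite -T_xgi -mulrA T_giK mulr1.
move: a; apply: T_ind => [c u v eu ev||a IH|a IH].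
- by rewrite !linearP /= eu ev.
- by rewrite !antipode1.
- by rewrite !T_antipodeM IH !Sg.
- by rewrite !T_antipodeM IH !Sx !linearN /= Sx opprK.
Qed.

Lemma T_antipode_inj : lker (@antipode K T) == 0%VS.
Proof.
apply/lker0P => a b /(congr1 (fun c => antipode (antipode (antipode c)))).
by rewrite !T_antipode4.
Qed.

End T421.

(** * The dual of T(4,2,1): products, actions and coproducts of G and X *)

Section T421Dual.

Context {K : fieldType} {T : hopfAlgType K} {g x : T}.
Hypothesis TP : is_T421 g x.
Context {zeta : K}.
Hypothesis zetaP : 4.-primitive_root zeta.
Context {G X : hdual T}.
Hypothesis GP : forall k l : nat, (k <= 1)%N -> (l <= 3)%N ->
  G (x ^+ k * g ^+ l) = (k == 0%N)%:R * zeta ^+ l.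
Hypothesis XP : forall k l : nat, (k <= 1)%N -> (l <= 3)%N ->
  X (x ^+ k * g ^+ l) = (k == 1%N)%:R.

Local Notation gi := (g ^+ 3).
Local Notation tliftEK := (tliftE (K := K)).
Local Notation "p *' q" := (dual_mul p q) (at level 40, left associativity).
Local Notation eps := (counit : hdual T).

Lemma zeta_sqr : zeta ^+ 2 = -1.
Proof.
have /eqP := prim_expr_order zetaP; rewrite (exprM zeta 2 2) sqrf_eq1.
by rewrite -(prim_order_dvd zetaP) => /eqP.
Qed.

Lemma zeta_sqrX l : zeta ^+ (2 * l) = (-1) ^+ l.
Proof. by rewrite exprM zeta_sqr. Qed.

(** If 2 were 0, then zeta^2 = -1 would be 1, against order 4. Fourier inversion divides by 4. *)
Lemma two_neq0 : 2%:R != 0 :> K.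
Proof.
apply/eqP => two0; have : zeta ^+ 2 == 1.
  by rewrite zeta_sqr -subr_eq0 -opprD oppr_eq0 -(natrD _ 1 1) two0.
by rewrite -(prim_order_dvd zetaP).
Qed.

Lemma g_mod l : g ^+ l = g ^+ (l %% 4).
Proof. by rewrite (expr_mod _ (T_g4 TP)). Qed.

(** The exponent is unrestricted because g^4 = 1 and zeta^4 = 1; this spares the later evaluations
    any reduction modulo 4. *)
Lemma G_g l : G (g ^+ l) = zeta ^+ l.
Proof.
rewrite g_mod -[_ ^+ _]mul1r -(expr0 x) GP ?mul1r ?prim_expr_mod //.
by rewrite -ltnS ltn_pmod.
Qed.

Lemma G_xg l : G (x * g ^+ l) = 0.
Proof. by rewrite g_mod -{1}(expr1 x) GP ?mul0r // -ltnS ltn_pmod. Qed.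

Lemma X_g l : X (g ^+ l) = 0.
Proof. by rewrite g_mod -[_ ^+ _]mul1r -(expr0 x) XP // -ltnS ltn_pmod. Qed.

Lemma X_xg l : X (x * g ^+ l) = 1.
Proof. by rewrite g_mod -{1}(expr1 x) XP // -ltnS ltn_pmod. Qed.

Lemma eps_g l : eps (g ^+ l) = 1. Proof. exact: (T_counit_g TP l). Qed.

Lemma eps_xg l : eps (x * g ^+ l) = 0.
Proof. by rewrite /fun_of_dual counitM (T_counit_x TP) mul0r. Qed.

Lemma T_dual_eq (p q : hdual T) :
    (forall l, p (g ^+ l) = q (g ^+ l)) ->
    (forall l, p (x * g ^+ l) = q (x * g ^+ l)) -> p = q.
Proof.
move=> eqg eqxg; apply: hdual_eq; apply: (T_lin_eq TP); try exact: dualP.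
by move=> [|[|//]] l _ _; rewrite ?expr0 ?mul1r ?expr1.
Qed.

Lemma dual_mul_g p q l : (p *' q) (g ^+ l) = p (g ^+ l) * q (g ^+ l).
Proof.
by rewrite dual_mulE (T_grouplike TP) (tliftEK _ _ (hdualM_bilin _ _)).
Qed.

(** The two terms are those of Delta(x g^l); the shifted exponent in the first one produces the zeta
    in GX = zeta XG. *)
Lemma dual_mul_xg p q l : (p *' q) (x * g ^+ l) =
  p (g ^+ l.+1) * q (x * g ^+ l) + p (x * g ^+ l) * q (g ^+ l).
Proof.
by rewrite dual_mulE (T_comul_xg TP) linearD /= !(tliftEK _ _ (hdualM_bilin _ _)).
Qed.

Let dual_valE := (dual_mul_g, dual_mul_xg, G_g, G_xg, X_g, X_xg, eps_g, eps_xg,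
  (@hdualDE K T, @hdualZE K T, @hdualNE K T, @hdual0E K T),
  (@mulr0 K, @mul0r K, @mulr1 K, @mul1r K, @addr0 K, @add0r K, @oppr0 K)).

Lemma dual_GX : G *' X = zeta *: (X *' G).
Proof. by apply: T_dual_eq => l; rewrite !dual_valE // exprS. Qed.

Lemma dual_XX : X *' X = 0.
Proof. by apply: T_dual_eq => l; rewrite !dual_valE. Qed.

Lemma dual_G4 : G *' (G *' (G *' G)) = eps.
Proof.
apply: T_dual_eq => l; rewrite !dual_valE //.
rewrite -!exprD (_ : (l + (l + (l + l)))%N = (4 * l)%N); last by rewrite !mulSn addn0.
by rewrite exprM (prim_expr_order zetaP) expr1n.
Qed.

Lemma T_conj_g l : gi * g ^+ l * g = g ^+ l.
Proof. by rewrite -mulrA -(exprSr g l) (exprS g l) mulrA (T_giK TP) mul1r. Qed.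

Lemma T_conj_xg l : gi * (x * g ^+ l) * g = - (x * g ^+ l).
Proof.
rewrite (mulrA gi x) (_ : gi * x = - (x * gi)); last by rewrite (T_xgi TP) opprK.
by rewrite !mulNr -(mulrA x gi) -(mulrA x _ g) T_conj_g.
Qed.

Lemma T_x_conj_g l : - (x * gi) * g ^+ l * g = - (x * g ^+ l).
Proof. by rewrite !mulNr -(mulrA x gi) -(mulrA x _ g) T_conj_g. Qed.

Lemma T_xxg l : x * (x * g ^+ l) = g ^+ l.+2 - g ^+ l.
Proof. by rewrite mulrA (T_xx TP) mulrBl mul1r -mulrA -!exprS. Qed.

Lemma T_x_conj_xg l : - (x * gi) * (x * g ^+ l) * g = g ^+ l.+2 - g ^+ l.
Proof.
by rewrite !mulNr -(mulrA x gi) -(mulrA x _ g) T_conj_xg mulrN opprK T_xxg.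
Qed.

Lemma T_xgx l : x * g ^+ l * x = (-1) ^+ l *: (g ^+ l.+2 - g ^+ l).
Proof. by rewrite -mulrA (T_gx_exp TP) -scalerAr T_xxg. Qed.

Lemma dualB (p : hdual T) a b : p (a - b) = p a - p b.
Proof. exact: (linB (dualP p)). Qed.
Lemma dualN (p : hdual T) a : p (- a) = - p a.
Proof. exact: (linN (dualP p)). Qed.
Lemma dualZ (p : hdual T) c a : p (c *: a) = c * p a.
Proof. exact: (linZ (dualP p)). Qed.

Lemma zetaSS l : zeta ^+ l.+2 - zeta ^+ l = - 2%:R * zeta ^+ l.
Proof. by rewrite -addn2 exprD zeta_sqr mulrN1 mulNr mulr_natl mulr2n opprD. Qed.

Lemma dual_act_conj_G : dual_act gi g G = G.
Proof.
by apply: T_dual_eq => l; rewrite dual_actE ?T_conj_g // T_conj_xg dualN G_xg oppr0.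
Qed.

Lemma dual_act_conj_X : dual_act gi g X = - X.
Proof.
apply: T_dual_eq => l; rewrite dual_actE hdualNE ?T_conj_g ?T_conj_xg ?dualN //.
by rewrite X_g oppr0.
Qed.

(** At g^l the functional is X(-x g^l) = -1, whatever l is: this is the source of the term -g in xX
    - Xx. *)
Lemma dual_act_x_X : dual_act (- (x * gi)) g X = - eps.
Proof.
apply: T_dual_eq => l; rewrite dual_actE hdualNE ?T_x_conj_g ?T_x_conj_xg.
  by rewrite dualN X_xg eps_g.
by rewrite dualB !X_g subrr eps_xg oppr0.
Qed.

Lemma dual_act_1g_X : dual_act 1 g X = X.
Proof.
by apply: T_dual_eq => l; rewrite dual_actE mul1r -?mulrA -exprSr ?X_g ?X_xg.
Qed.

(** Moving x to the left past g^l costs (-1)^l = zeta^(2l), the value of G^2 at g^l. *)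
Lemma dual_act_1x_X : dual_act 1 x X = G *' G.
Proof.
apply: T_dual_eq => l; rewrite dual_actE mul1r.
  rewrite (T_gx_exp TP) dualZ X_xg mulr1 dual_mul_g G_g -exprD addnn.
  by rewrite -mul2n zeta_sqrX.
by rewrite T_xgx dualZ dualB !X_g subrr mulr0 dual_mul_xg !G_xg mulr0 mul0r addr0.
Qed.

Lemma dual_act_x_G : dual_act (- (x * gi)) g G = - 2%:R *: (X *' G).
Proof.
apply: T_dual_eq => l; rewrite dual_actE hdualZE ?T_x_conj_g ?T_x_conj_xg.
  by rewrite dualN G_xg oppr0 dual_mul_g X_g mul0r mulr0.
by rewrite dualB !G_g zetaSS dual_mul_xg X_g X_xg mul0r add0r mul1r G_g.
Qed.

Lemma dual_act_1g_G : dual_act 1 g G = zeta *: G.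
Proof.
apply: T_dual_eq => l;
  rewrite dual_actE mul1r -?mulrA -exprSr hdualZE ?G_g ?G_xg ?mulr0 //.
by rewrite exprS.
Qed.

(** The sign (-1)^l from moving x past g^l turns zeta^l into zeta^(3l), hence G into G^3 beside
    X. *)
Lemma dual_act_1x_G : dual_act 1 x G = - 2%:R *: (X *' (G *' (G *' G))).
Proof.
apply: T_dual_eq => l; rewrite dual_actE mul1r hdualZE.
  by rewrite (T_gx_exp TP) dualZ G_xg mulr0 dual_mul_g X_g mul0r mulr0.
rewrite T_xgx dualZ dualB !G_g zetaSS dual_mul_xg X_g X_xg mul0r add0r mul1r.
by rewrite !dual_mul_g !G_g -zeta_sqrX mul2n -addnn exprD mulrCA [in RHS]mulrA.
Qed.

(** The four cases are the products g^l g^m, g^l x g^m, x g^l g^m and x g^l x g^m of basis elements,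
    brought to normal form, the last one through x^2 = g^2 - 1. *)
Lemma T_dual_comul_eq (p : hdual T) (t : tensor (hdual T) (hdual T)) :
    let ev (a b : T) := tlift (fun q r : hdual T => q a * r b : K^o) t in
    (forall l m, p (g ^+ (l + m)) = ev (g ^+ l) (g ^+ m)) ->
    (forall l m, (-1) ^+ l * p (x * g ^+ (l + m)) = ev (g ^+ l) (x * g ^+ m)) ->
    (forall l m, p (x * g ^+ (l + m)) = ev (x * g ^+ l) (g ^+ m)) ->
    (forall l m, (-1) ^+ l * (p (g ^+ (l + m).+2) - p (g ^+ (l + m))) =
       ev (x * g ^+ l) (x * g ^+ m)) ->
  dual_comul p = t.
Proof.
move=> ev gg gx xg xx; apply: dual_tensor_eq => a b; rewrite dual_comulE -/(ev a b).
have evl c : linear (ev^~ c).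
  apply: (tlift_linear_param (B := fun (a : T) (q r : hdual T) => q a * r c : K^o)).
  by move=> q r k u v; rewrite (dualP q) mulrDl -mulrA.
have evr c : linear (ev c).
  apply: (tlift_linear_param (B := fun (a : T) (q r : hdual T) => q c * r a : K^o)).
  by move=> q r k u v; rewrite (dualP r) mulrDr mulrCA.
move: a; apply: (T_lin_eq TP) => [c u v||k l k1 _]; [|exact: evl|].
  by rewrite mulrDl -scalerAl (dualP p).
move: b; apply: (T_lin_eq TP) => [c u v||k' m k1' _]; [|exact: evr|].
  by rewrite mulrDr -scalerAr (dualP p).
case: k k1 => [|[|//]] _; case: k' k1' => [|[|//]] _; rewrite ?expr0 ?expr1 ?mul1r.
- by rewrite -exprD.
- by rewrite mulrA (T_gx_exp TP) -scalerAl -mulrA -exprD dualZ.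
- by rewrite -mulrA -exprD.
rewrite mulrA T_xgx -scalerAl mulrBl -!exprD dualZ dualB !addSn; exact: xx.
Qed.

Lemma dual_comul_X : dual_comul X = X ⊗ eps + (G *' G) ⊗ X.
Proof.
apply: T_dual_comul_eq => l m;
  rewrite linearD /= !(tliftEK _ _ (dual_eval_bilin _ _)) !dual_valE //.
by rewrite -exprD addnn -mul2n zeta_sqrX.
Qed.

(** Only the products x g^l x g^m see the correction term: G takes there the value -2 (-1)^l
    zeta^(l+m), which factors as -2 zeta^(3l) zeta^m. *)
Lemma dual_comul_G : dual_comul G =
  G ⊗ G - 2%:R *: ((X *' (G *' (G *' G))) ⊗ (X *' G)).
Proof.
apply: T_dual_comul_eq => l m;
  rewrite linearB linearZ /= !(tliftEK _ _ (dual_eval_bilin _ _)) !dual_valE //.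
- by rewrite exprD scaler0; apply/esym/subr0.
- by rewrite scaler0; apply/esym/oppr0.
- by rewrite scaler0; apply/esym/oppr0.
rewrite zetaSS exprD -zeta_sqrX mul2n -addnn exprD -[_ *: _]/(_ * _).
by rewrite mulNr mulrN mulrCA !mulrA.
Qed.

(** The functional X^a G^b, by iterated left multiplication: [dual_mul] is a bare operation without
    powers. *)
Definition dual_mon a b : hdual T := iter a (dual_mul X) (iter b (dual_mul G) eps).

Lemma dual_mon0_g b l : dual_mon 0 b (g ^+ l) = zeta ^+ (b * l).
Proof.
elim: b => [|b IH]; first exact: eps_g.
by rewrite [LHS]dual_mul_g IH G_g -exprD mulSn.
Qed.

Lemma dual_mon0_xg b l : dual_mon 0 b (x * g ^+ l) = 0.
Proof.
elim: b => [|b IH]; first exact: eps_xg.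
by rewrite [LHS]dual_mul_xg IH G_xg mulr0 mul0r addr0.
Qed.

Lemma dual_mon1_g b l : dual_mon 1 b (g ^+ l) = 0.
Proof. by rewrite [LHS]dual_mul_g X_g mul0r. Qed.

Lemma dual_mon1_xg b l : dual_mon 1 b (x * g ^+ l) = zeta ^+ (b * l).
Proof. by rewrite [LHS]dual_mul_xg X_g X_xg mul0r add0r mul1r dual_mon0_g. Qed.

(** A geometric sum with ratio zeta^(3l+m), a fourth root of unity that is 1 exactly when l = m, as
    3l is -l modulo 4. *)
Lemma zeta_orth l m : (l < 4)%N -> (m < 4)%N ->
  \sum_(b < 4) zeta ^+ (b * (3 * l + m)) = 4%:R *+ (l == m).
Proof.
move=> l4 m4; set w := zeta ^+ (3 * l + m).
under eq_bigr do rewrite mulnC exprM -/w.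
have w1 : (w == 1) = (l == m).
  rewrite -(prim_order_dvd zetaP).
  by case: l m l4 m4 {w} => [|[|[|[|//]]]] [|[|[|[|//]]]].
rewrite -w1; case: eqP => [->|/eqP wn1].
  by under eq_bigr do rewrite expr1n; rewrite sumr_const card_ord.
apply: (mulfI (x := w - 1)); first by rewrite subr_eq0.
by rewrite -subrX1 mulr0 /w -exprM mulnC exprM (prim_expr_order zetaP) expr1n subrr.
Qed.

(* Fourier inversion on Z/4: zeta ^+ (b * (3 * l)) is zeta^(-bl). *)
Lemma dual_mon_span (p : hdual T) : p = \sum_(a < 2) \sum_(b < 4)
  (4%:R^-1 * \sum_(l < 4) zeta ^+ (b * (3 * l)) * p (x ^+ a * g ^+ l)) *: dual_mon a b.
Proof.
have four0 : 4%:R != 0 :> K by rewrite (natrM _ 2 2) mulf_neq0 // two_neq0.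
(* Inversion for a single function c on Z/4. It is applied to p(g^l) for a = 0 and to p(x g^l) for a
   = 1; the monomials with the other a vanish on those elements. *)
have key (c : nat -> K) m : (m < 4)%N -> c m =
    \sum_(b < 4) (4%:R^-1 * \sum_(l < 4) zeta ^+ (b * (3 * l)) * c l) * zeta ^+ (b * m).
  move=> m4; transitivity
    (4%:R^-1 * \sum_(l < 4) c l * \sum_(b < 4) zeta ^+ (b * (3 * l + m))).
    rewrite (bigD1 (Ordinal m4)) //= zeta_orth // eqxx mulr1n big1 ?addr0.
      by rewrite mulrCA mulVf // mulr1.
    move=> l lm; rewrite zeta_orth // (_ : (l == m :> nat) = false) ?mulr0 //.
    by apply: negPf; apply: contra lm => /eqP lm; apply/eqP/val_inj.
  under eq_bigr do rewrite mulr_sumr.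
  rewrite exchange_big mulr_sumr; apply: eq_bigr => b _.
  rewrite -mulrA mulr_suml; congr (_ * _); apply: eq_bigr => l _.
  by rewrite mulnDr exprD mulrA [c l * _]mulrC.
apply: hdual_eq; apply: (T_lin_eq TP); try exact: dualP.
move=> k l k1 l3; set h := x ^+ k * g ^+ l.
have sumE (c : 'I_2 -> 'I_4 -> K) :
    (\sum_a \sum_b c a b *: dual_mon a b : hdual T) h =
    \sum_a \sum_b c a b * dual_mon a b h.
  rewrite /fun_of_dual sum_lfunE; apply: eq_bigr => a _.
  by rewrite sum_lfunE; apply: eq_bigr => b _; rewrite lfunE.
rewrite sumE (big_ord_recl 1) (big_ord_recl 0) big_ord0 addr0 /h /=.
case: k k1 {h sumE} => [|[|//]] _; rewrite ?expr0 ?expr1 ?mul1r.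
  under [X in _ = _ + X]eq_bigr do rewrite dual_mon1_g mulr0.
  rewrite [X in _ = _ + X]big1 // addr0.
  under eq_bigr do rewrite dual_mon0_g.
  have := key (fun l => p (x ^+ 0 * g ^+ l)) _ l3.
  by rewrite {1}expr0 mul1r.
under [X in _ = X + _]eq_bigr do rewrite dual_mon0_xg mulr0.
rewrite [X in _ = X + _]big1 // add0r.
under eq_bigr do rewrite dual_mon1_xg.
have := key (fun l => p (x ^+ 1 * g ^+ l)) _ l3.
by rewrite {1}expr1.
Qed.

End T421Dual.

(** * Presentations *)

Section FreeEval.

Context {K : fieldType} {A : lmodType K} {n : nat}.
Variables (mul : A -> A -> A) (one : A) (s : 'I_n -> A).
Hypothesis bil : bilin mul.
Hypothesis mulA : associative mul.
Hypothesis mul1 : left_id one mul.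
Hypothesis mulr1 : right_id one mul.

Definition word_eval (w : {fmonom 'I_n}) : A := foldr (fun i => mul (s i)) one w.

Definition free_eval (p : free_alg K n) : A :=
  \sum_(w <- msupp p) p@_w *: word_eval w.

(** Summation over a larger finite set lets two elements be expanded over a common support. *)
Lemma free_evalEw (d : {fset {fmonom 'I_n}}) (p : free_alg K n) :
  (msupp p `<=` d)%fset -> free_eval p = \sum_(w <- d) p@_w *: word_eval w.
Proof.
move=> le; rewrite [LHS](big_fset_incl _ le) => //= w _ /mcoeff_outdom ->.
by rewrite scale0r.
Qed.

Lemma free_eval_lin : linear free_eval.
Proof.
move=> c p q; pose d := (msupp p `|` msupp q)%fset.
rewrite !(@free_evalEw d) ?fsubsetUl ?fsubsetUr //; last first.
  by apply: fsubset_trans (msuppD_le _ _) _; apply: fsetSU; apply: msuppZ_le.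
rewrite scaler_sumr -big_split; apply: eq_bigr => w _ /=.
by rewrite mcoeffD mcoeffZ scalerDl scalerA.
Qed.

Lemma free_evalU (c : K) w : free_eval << c *g w >> = c *: word_eval w.
Proof.
by rewrite (@free_evalEw [fset w]%fset) ?msuppU_le // big_seq_fset1 mcoeffUU.
Qed.

Lemma free_eval_var i : free_eval (fvar K i) = s i.
Proof. by rewrite /fvar free_evalU scale1r /word_eval fmuE /= mulr1. Qed.

Lemma free_eval1 : free_eval 1 = one.
Proof. by rewrite [LHS]free_evalU scale1r /word_eval fm1. Qed.

Lemma word_evalM (u v : {fmonom 'I_n}) :
  word_eval (fmmul u v) = mul (word_eval u) (word_eval v).
Proof.
rewrite /word_eval fmmulE /= foldr_cat.
by case: u => /= u; elim: u => [|i u IH] //=; rewrite IH mulA.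
Qed.

Lemma free_evalM : {morph free_eval : p q / p * q >-> mul p q}.
Proof.
have lf := free_eval_lin; have [ml mr] := bil.
move=> p q; rewrite malgME (lin_sum lf) {2}/free_eval (lin_sum (ml _)).
apply: eq_bigr => u _; rewrite (lin_sum lf) {2}/free_eval (lin_sum (mr _)).
apply: eq_bigr => v _; rewrite free_evalU [word_eval _]word_evalM.
by rewrite (linZ (mr _)) (linZ (ml _)) scalerA mulrC.
Qed.

Lemma free_eval_morphism : alg_morphism *%R 1 mul one free_eval.
Proof. split; [exact: free_eval_lin|exact: free_eval1|exact: free_evalM]. Qed.

End FreeEval.

(** An [lalgType] relates scalars only to left factors; multiplying a span on the left needs this
    compatibility with right factors. *)
Lemma free_scalerAr (K : fieldType) (n : nat) (c : K) (p q : free_alg K n) :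
  p * (c *: q) = c *: (p * q).
Proof.
apply/malgP => w.
rewrite mcoeffZ (mcoeffMlw w (fsubset_refl _) (msuppZ_le c q)) mcoeffMl mulr_sumr.
apply: eq_bigr => u _; rewrite mulr_sumr; apply: eq_bigr => v _.
by rewrite mcoeffZ mulrnAr mulrCA.
Qed.

(** Words grow by letters on the left, matching the left stability proved for the span of the normal
    words. *)
Lemma free_ind (K : fieldType) (n : nat) (P : free_alg K n -> Prop) :
    (forall (c : K) (p q : free_alg K n), P p -> P q -> P (c *: p + q)) -> P 1 ->
    (forall i p, P p -> P (fvar K i * p)) -> forall p, P p.
Proof.
move=> Plin P1 Pvar p.
have P0 : P 0 by have := Plin (-1) _ _ P1 P1; rewrite scaleN1r addNr.
have Pw (w : {fmonom 'I_n}) : P << w >>.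
  case: w => w; elim: w => [|i w IH].
    by rewrite (_ : << _ >> = 1) // -[RHS]/(<< fmone _ >>) fmoneE.
  rewrite (_ : << _ >> = fvar K i * << FMonom w >>); first exact: Pvar.
  rewrite /fvar malgM_def fgmulUU mulr1 fmuE; congr << _ >>.
  exact/esym/fmmulE.
rewrite [p]monalgE; elim/big_ind: _ => // [u v Pu Pv|w _].
  by rewrite -[u]scale1r; apply: Plin.
rewrite (_ : << _ *g _ >> = p@_w *: << w >> + 0); first exact: Plin.
by rewrite addr0; apply/malgP => u; rewrite mcoeffZ !mcoeffU mulrnAr mulr1.
Qed.

(** The free algebra is in general infinite-dimensional, so its spans are not treated as subspaces
    of a [vectType]; membership is generated inductively. *)
Inductive lspan (K : fieldType) (V : lmodType K) (M : seq V) : V -> Prop :=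
| LSpan0 : lspan M 0
| LSpanD (c : K) u v of u \in M & lspan M v : lspan M (c *: u + v).

Section Lspan.

Context {K : fieldType} {V : lmodType K} {M : seq V}.

Lemma lspan_lin (c : K) (u v : V) : lspan M u -> lspan M v -> lspan M (c *: u + v).
Proof.
move=> uM vM; elim: uM => [|c' m w mM _ IH]; first by rewrite scaler0 add0r.
by rewrite scalerDr scalerA -addrA; apply: LSpanD.
Qed.

Lemma lspan_mem u : u \in M -> lspan M u.
Proof.
by move=> uM; rewrite -[u]scale1r -[_ *: u]addr0; apply: LSpanD (LSpan0 _).
Qed.

Lemma lspan_coef u : lspan M u ->
  exists c : 'I_(size M) -> K, u = \sum_i c i *: M`_i.
Proof.
elim=> [|c m v mM _ [d ->]].
  by exists (fun=> 0); rewrite big1 // => i _; rewrite scale0r.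
have iM : (index m M < size M)%N by rewrite index_mem.
(* The new coefficient is added at the first position of m, which also settles repetitions in M. *)
exists (fun i => (if i == Ordinal iM then c else 0) + d i).
under [RHS]eq_bigr do rewrite scalerDl.
rewrite big_split /=; congr (_ + _); rewrite (bigD1 (Ordinal iM)) //= eqxx.
rewrite big1 ?addr0 => [|i /negPf ->]; last by rewrite scale0r.
by rewrite nth_index.
Qed.

End Lspan.

(** * Normal words modulo the relations *)

Section IdealCongruence.

Context {K : fieldType} {R : lalgType K}.
Variable E : seq (R * R).
Implicit Types (p q r : R) (M : seq R).

Hypothesis scalerAr : forall (c : K) p q, p * (c *: q) = c *: (p * q).

Definition cong p q := ideal_gen E (p - q).

Lemma ideal_genZ (c : K) p : ideal_gen E p -> ideal_gen E (c *: p).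
Proof. by move=> pE; rewrite -[p]mul1r scalerAl; apply: IdealMl. Qed.

Lemma cong_refl p : cong p p.
Proof. by rewrite /cong subrr; apply: Ideal0. Qed.

Lemma cong_trans q p r : cong p q -> cong q r -> cong p r.
Proof. by move=> pq qr; rewrite /cong -(subrK q p) -addrA; apply: IdealD. Qed.

Lemma cong_lin (c : K) p p' q q' :
  cong p p' -> cong q q' -> cong (c *: p + q) (c *: p' + q').
Proof.
move=> pp qq; rewrite /cong opprD addrACA -scalerBr.
by apply: IdealD => //; apply: ideal_genZ.
Qed.

Lemma congMl r p q : cong p q -> cong (r * p) (r * q).
Proof. by move=> pq; rewrite /cong -mulrBr; apply: IdealMl. Qed.

Lemma congMr r p q : cong p q -> cong (p * r) (q * r).
Proof. by move=> pq; rewrite /cong -mulrBl; apply: IdealMr. Qed.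

Lemma cong_rel i : (i < size E)%N -> cong (nth (0, 0) E i).1 (nth (0, 0) E i).2.
Proof. by move=> iE; apply/IdealGen/mem_nth. Qed.

(** Membership in the span of M within the quotient by the ideal, without forming the quotient. *)
Definition cspan M p := exists2 q, lspan M q & cong p q.

Lemma cspan_cong M p q : cong p q -> cspan M q -> cspan M p.
Proof. by move=> pq [r rM qr]; exists r => //; apply: cong_trans qr. Qed.

Lemma cspan_lin M (c : K) p q : cspan M p -> cspan M q -> cspan M (c *: p + q).
Proof.
move=> [p' p'M pp'] [q' q'M qq'].
by exists (c *: p' + q'); [apply: lspan_lin|apply: cong_lin].
Qed.

Lemma cspan_mem M p : p \in M -> cspan M p.
Proof. by move=> pM; exists p; [apply: lspan_mem|apply: cong_refl]. Qed.

Lemma cspan0 M : cspan M 0.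
Proof. by exists 0; [apply: LSpan0|apply: cong_refl]. Qed.

Lemma cspanD M p q : cspan M p -> cspan M q -> cspan M (p + q).
Proof. by move=> pM qM; rewrite -[p]scale1r; apply: cspan_lin. Qed.

Lemma cspanZ M (c : K) p : cspan M p -> cspan M (c *: p).
Proof. by move=> pM; rewrite -[_ *: p]addr0; apply: cspan_lin => //; apply: cspan0. Qed.

Lemma cspanN M p : cspan M p -> cspan M (- p).
Proof. by move=> pM; rewrite -scaleN1r; apply: cspanZ. Qed.

Lemma cspan_mull M M' r p :
  (forall m, m \in M -> cspan M' (r * m)) -> cspan M p -> cspan M' (r * p).
Proof.
move=> rM [q qM pq]; apply: (cspan_cong (congMl r pq)).
elim: qM => [|c u v uM _ IH]; first by rewrite mulr0; apply: cspan0.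
by rewrite mulrDr scalerAr; apply: cspan_lin => //; apply: rM.
Qed.

Variables g x G X : R.
Variable zeta : K.
Hypothesis g4 : cong (g ^+ 4) 1.
Hypothesis G4 : cong (G ^+ 4) 1.
Hypothesis xx : cong (x ^+ 2) (g ^+ 2 - 1).
Hypothesis XX : cong (X ^+ 2) 0.
Hypothesis gx : cong (g * x) (- (x * g)).
Hypothesis GX : cong (G * X) (zeta *: (X * G)).
Hypothesis gG : cong (g * G) (G * g).
Hypothesis gX : cong (g * X) (- (X * g)).
Hypothesis xX : cong (x * X - X * x) (G ^+ 2 - g).
Hypothesis xG : cong (x * G - zeta *: (G * x)) (- 2%:R *: (X * G * (g + G ^+ 2))).

(* The normal words X^a G^b x^c g^d are added one letter at a time, from the
   right; at each stage the span modulo the relations is stable under left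
   multiplication by the letters used so far, finally by all four. *)
Definition mulX (a : R) n M : seq R := [seq a ^+ k * m | k <- iota 0 n, m <- M].

Lemma cspan_sub a n M p : (0 < n)%N -> cspan M p -> cspan (mulX a n M) p.
Proof.
move=> n0 pM; rewrite -[p]mul1r; apply: cspan_mull pM => m mM.
apply: cspan_mem; apply/allpairsP; exists (0%N, m).
by rewrite mem_iota expr0.
Qed.

Lemma cspan_mulX a n M k p : (k < n)%N -> cspan M p -> cspan (mulX a n M) (a ^+ k * p).
Proof.
move=> kn; apply: cspan_mull => m mM.
by apply: cspan_mem; apply/allpairsP; exists (k, m); rewrite mem_iota.
Qed.

Lemma cspan_mulX_mull a n M M' r p :
    (forall k m, (k < n)%N -> m \in M -> cspan M' (r * (a ^+ k * m))) ->
  cspan (mulX a n M) p -> cspan M' (r * p).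
Proof.
move=> rM; apply: cspan_mull => _ /allpairsP[[k m] [/= kn mM ->]]; apply: rM => //.
by move: kn; rewrite mem_iota.
Qed.

Lemma cong_sub p q r : cong (p - q) r -> cong p (q + r).
Proof. by rewrite /cong opprD addrA. Qed.

Local Notation Mg := (mulX g 4 [:: 1]).
Local Notation Mx := (mulX x 2 Mg).
Local Notation MG := (mulX G 4 Mx).
Local Notation MX := (mulX X 2 MG).

Lemma Mg_g p : cspan Mg p -> cspan Mg (g * p).
Proof.
apply: cspan_mulX_mull => k m k4 mM; rewrite mulrA -exprS.
have mM' := cspan_mem mM.
case: (ltnP k.+1 4) => [k4'|k3]; first exact: cspan_mulX.
have -> : k.+1 = 4 by apply/eqP; rewrite eqn_leq k3 k4.
by apply: (cspan_cong (congMr m g4)); rewrite mul1r; apply: cspan_sub.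
Qed.

Lemma Mx_x p : cspan Mx p -> cspan Mx (x * p).
Proof.
apply: cspan_mulX_mull => k m k2 mM; have mM' := cspan_mem mM.
case: k k2 => [|[|//]] _; first by rewrite expr0 mul1r -[x]expr1; apply: cspan_mulX.
rewrite mulrA -exprS; apply: (cspan_cong (congMr m xx)); apply: cspan_sub => //.
rewrite mulrBl mul1r; apply: cspanD; last exact: cspanN.
by rewrite expr2 -mulrA; do 2!apply: Mg_g.
Qed.

Lemma Mx_g p : cspan Mx p -> cspan Mx (g * p).
Proof.
apply: cspan_mulX_mull => k m k2 mM; have mM' := cspan_mem mM.
case: k k2 => [|[|//]] _.
  by rewrite expr0 mul1r; apply: cspan_sub => //; apply: Mg_g.
rewrite expr1 mulrA; apply: (cspan_cong (congMr m gx)); rewrite mulNr -mulrA.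
by apply/cspanN/Mx_x/cspan_sub => //; apply: Mg_g.
Qed.

Lemma MG_G p : cspan MG p -> cspan MG (G * p).
Proof.
apply: cspan_mulX_mull => k m k4 mM; rewrite mulrA -exprS.
have mM' := cspan_mem mM.
case: (ltnP k.+1 4) => [k4'|k3]; first exact: cspan_mulX.
have -> : k.+1 = 4 by apply/eqP; rewrite eqn_leq k3 k4.
by apply: (cspan_cong (congMr m G4)); rewrite mul1r; apply: cspan_sub.
Qed.

Lemma MG_Gn k p : cspan MG p -> cspan MG (G ^+ k * p).
Proof.
move=> pM; elim: k => [|k IH]; first by rewrite expr0 mul1r.
by rewrite exprS -mulrA; apply: MG_G.
Qed.

(** g commutes with G modulo the relations, so it passes through G^k one factor at a time, down to
    the words in x and g. *)
Lemma MG_g p : cspan MG p -> cspan MG (g * p).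
Proof.
apply: cspan_mulX_mull => k m _ mM.
have {mM} : cspan Mx m by exact: cspan_mem.
elim: k m => [|k IH] m mM.
  by rewrite expr0 mul1r; apply: cspan_sub => //; apply: Mx_g.
rewrite exprS -mulrA [g * _]mulrA; apply: (cspan_cong (congMr _ gG)).
by rewrite -mulrA; apply/MG_G/IH.
Qed.

Lemma MX_X p : cspan MX p -> cspan MX (X * p).
Proof.
apply: cspan_mulX_mull => k m k2 mM; have mM' := cspan_mem mM.
case: k k2 => [|[|//]] _; first by rewrite expr0 mul1r -[X]expr1; apply: cspan_mulX.
rewrite mulrA -exprS; apply: (cspan_cong (congMr m XX)); rewrite mul0r.
exact: cspan0.
Qed.

Lemma MX_G p : cspan MX p -> cspan MX (G * p).
Proof.
apply: cspan_mulX_mull => k m k2 mM; have mM' := cspan_mem mM.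
case: k k2 => [|[|//]] _.
  by rewrite expr0 mul1r; apply: cspan_sub => //; apply: MG_G.
rewrite expr1 mulrA; apply: (cspan_cong (congMr m GX)); rewrite -scalerAl -mulrA.
by apply/cspanZ/MX_X/cspan_sub => //; apply: MG_G.
Qed.

Lemma MX_g p : cspan MX p -> cspan MX (g * p).
Proof.
apply: cspan_mulX_mull => k m k2 mM; have mM' := cspan_mem mM.
case: k k2 => [|[|//]] _.
  by rewrite expr0 mul1r; apply: cspan_sub => //; apply: MG_g.
rewrite expr1 mulrA; apply: (cspan_cong (congMr m gX)); rewrite mulNr -mulrA.
by apply/cspanN/MX_X/cspan_sub => //; apply: MG_g.
Qed.

(** Moving x past G creates a factor X, so the result leaves the span of the words without X and the
    target is [MX]. The new terms need only stability under X, G and g, which is already known. *)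
Lemma MX_xMG p : cspan MG p -> cspan MX (x * p).
Proof.
apply: cspan_mulX_mull => k m _ mM.
have {mM} : cspan Mx m by exact: cspan_mem.
elim: k m => [|k IH] m mM.
  by rewrite expr0 mul1r; do 2!apply: cspan_sub => //; apply: Mx_x.
rewrite exprS -mulrA [x * _]mulrA; apply: (cspan_cong (congMr _ (cong_sub xG))).
have GkM : cspan MX (G ^+ k * m) by apply/cspan_sub/MG_Gn/cspan_sub.
rewrite mulrDl -!scalerAl; apply: cspanD; apply: cspanZ; rewrite -!mulrA.
  by apply/MX_G/IH.
apply/MX_X/MX_G; rewrite mulrDl expr2 -mulrA.
by apply: cspanD; [apply: MX_g|do 2!apply: MX_G].
Qed.

(** For a word with one X, the relation xX = Xx + G^2 - g puts x directly before a word without X,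
    the case of [MX_xMG]. *)
Lemma MX_x p : cspan MX p -> cspan MX (x * p).
Proof.
apply: cspan_mulX_mull => k m k2 mM; have mM' := cspan_mem mM.
case: k k2 => [|[|//]] _; first by rewrite expr0 mul1r; apply: MX_xMG.
rewrite expr1 mulrA; apply: (cspan_cong (congMr m (cong_sub xX))).
have mX : cspan MX m by exact: cspan_sub.
rewrite mulrDl mulrBl expr2 -!mulrA; apply: cspanD; first by apply/MX_X/MX_xMG.
by apply: cspanD; [do 2!apply: MX_G|apply/cspanN/MX_g].
Qed.

Lemma MX_1 : cspan MX 1.
Proof. by do 4!apply: cspan_sub => //; apply: cspan_mem; rewrite inE. Qed.

End IdealCongruence.

Definition double_rels (K : fieldType) (R : lalgType K) (zeta : K) (g x G X : R) :
    seq (R * R) :=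
  [:: (G ^+ 4, 1); (g ^+ 4, 1);
      (x ^+ 2, g ^+ 2 - 1);
      (X ^+ 2, 0);
      (g * x, - (x * g));
      (G * X, zeta *: (X * G));
      (g * G, G * g);
      (g * X, - (X * g));
      (x * X - X * x, G ^+ 2 - g);
      (x * G - zeta *: (G * x), - 2 *: (X * G * (g + G ^+ 2)))].

Lemma double_rels_span (K : fieldType) (R : lalgType K) (zeta : K) (g x G X : R) :
    (forall (c : K) (p q : R), p * (c *: q) = c *: (p * q)) ->
    let E := double_rels zeta g x G X in
    let M := mulX X 2 (mulX G 4 (mulX x 2 (mulX g 4 [:: 1]))) in
  forall p, cspan E M p ->
  [/\ cspan E M (g * p), cspan E M (x * p), cspan E M (G * p) & cspan E M (X * p)].
Proof.
move=> scAr E M p pM; pose rel i := @cong_rel K R E i.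
have G4 : cong E (G ^+ 4) 1 := rel 0%N isT.
have g4 : cong E (g ^+ 4) 1 := rel 1%N isT.
have xx : cong E (x ^+ 2) (g ^+ 2 - 1) := rel 2%N isT.
have XX : cong E (X ^+ 2) 0 := rel 3%N isT.
have gx : cong E (g * x) (- (x * g)) := rel 4%N isT.
have GX : cong E (G * X) (zeta *: (X * G)) := rel 5%N isT.
have gG : cong E (g * G) (G * g) := rel 6%N isT.
have gX : cong E (g * X) (- (X * g)) := rel 7%N isT.
have xX : cong E (x * X - X * x) (G ^+ 2 - g) := rel 8%N isT.
have xG : cong E (x * G - zeta *: (G * x)) (- 2 *: (X * G * (g + G ^+ 2))).
  exact: rel 9%N isT.
by split; [exact: MX_g|exact: MX_x GX gG gX xX xG _ _|exact: MX_G GX _ _|exact: MX_X].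
Qed.

(** * Presentations from a spanning set bounded by the dimension *)

Section PresentedByDim.

Context {K : fieldType} {A : vectType K} {n : nat}.
Variables (mul : A -> A -> A) (one : A) (s : n.-tuple A).
Variables (E : seq (free_alg K n * free_alg K n)) (M : seq (free_alg K n)).
Variable phi : free_alg K n -> A.

(* The images of the spanning set M span A, hence are independent by the bound
   on its size; so the kernel is no larger than the ideal. *)
Lemma presented_by_dim :
    alg_morphism *%R 1 mul one phi -> bilin mul ->
    (forall i, phi (fvar K i) = tnth s i) ->
    (forall a, exists p, phi p = a) ->
    (forall i, (i < size E)%N ->
      phi (nth (0, 0) E i).1 = phi (nth (0, 0) E i).2) ->
    (forall p, cspan E M p) -> (size M <= \dim {:A})%N ->
  presented_by mul one s E.
Proof.
move=> phiP [ml mr] phis surj rel span dimM.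
have [lphi phi1 phiM] := phiP.
have ideal0 p : ideal_gen E p -> phi p = 0.
  elim=> [e eE||a b _ IHa _ IHb|a b _ IH|a b _ IH].
  - have /(nthP (0, 0))[i iE <-] := eE.
    by rewrite (linB lphi) rel // subrr.
  - exact: lin0.
  - by rewrite (linD lphi) IHa IHb addr0.
  - by rewrite phiM IH (lin0 (mr _)).
  - by rewrite phiM IH (lin0 (ml _)).
have phi_coef p : exists2 c : 'I_(size M) -> K,
    phi p = \sum_i c i *: phi M`_i & ideal_gen E (p - \sum_i c i *: M`_i).
  have [q /lspan_coef[c ->] pq] := span p; exists c => //.
  have := ideal0 _ pq; rewrite (linB lphi) => /eqP; rewrite subr_eq0 => /eqP ->.
  by rewrite (lin_sum lphi); apply: eq_bigr => i _; rewrite (linZ lphi).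
pose Y := [tuple phi M`_i | i < size M].
have Ynth (i : 'I_(size M)) : Y`_i = phi M`_i by rewrite -tnth_nth tnth_mktuple.
have freeY : free Y.
  suff : basis_of fullv Y by apply: basis_free.
  rewrite basisEdim size_tuple dimM andbT; apply/subvP => a _.
  have [p <-] := surj a; have [c -> _] := phi_coef p.
  apply: memv_suml => i _; apply: memvZ; rewrite -Ynth.
  by apply: memv_span; apply: mem_nth; rewrite size_tuple.
exists phi; split=> // p; split=> [p0|/ideal0 //].
have [c pE pq] := phi_coef p.
have c0 : forall i, c i = 0.
  apply: (elimT freeP freeY); rewrite -[RHS]p0 pE.
  by apply: eq_bigr => j _; rewrite Ynth.
by move: pq; rewrite big1 ?subr0 // => i _; rewrite c0 scale0r.
Qed.

End PresentedByDim.

(** * The double of T(4,2,1) *)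

Section DoubleT421.

Context {K : fieldType} {T : hopfAlgType K} {gT xT : T}.
Hypothesis TP : is_T421 gT xT.
Context {zeta : K}.
Hypothesis zetaP : 4.-primitive_root zeta.
Context {GT XT : hdual T}.
Hypothesis GTP : forall k l : nat, (k <= 1)%N -> (l <= 3)%N ->
  GT (xT ^+ k * gT ^+ l) = (k == 0%N)%:R * zeta ^+ l.
Hypothesis XTP : forall k l : nat, (k <= 1)%N -> (l <= 3)%N ->
  XT (xT ^+ k * gT ^+ l) = (k == 1%N)%:R.

Local Notation D := (drinfeld_double T).
Local Notation g := (double_in gT).
Local Notation x := (double_in xT).
Local Notation G := (double_in_dual GT).
Local Notation X := (double_in_dual XT).
Local Notation e := (double_one T).

Let S_inj := T_antipode_inj TP.
Let SM := T_antipodeM TP.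
Let giK := T_giK TP.
Let gKi := T_gKi TP.
Let comul_g := T_comul_g TP.
Let comul_x := T_comul_x TP.
Let bilD := double_mul_bilin (H := T).

Lemma T_double_mulA : associative (@double_mul K T).
Proof. exact: (double_mulA S_inj SM giK gKi comul_g comul_x (T_ind TP)). Qed.

Lemma T_double_mul1 : left_id e (@double_mul K T).
Proof. exact: (double_mul1 S_inj). Qed.

Lemma T_double_mulr1 : right_id e (@double_mul K T).
Proof. exact: (double_mulr1 S_inj SM giK gKi comul_g comul_x (T_ind TP)). Qed.

Lemma double_in_lin : linear (@double_in K T).
Proof. by move=> c u v; apply: pure_linr. Qed.

Lemma double_in_dual_lin : linear (@double_in_dual K T).
Proof. by move=> c u v; apply: pure_linl. Qed.

Lemma double_in_dual_mul p q :
  double_in_dual p *D double_in_dual q = double_in_dual (dual_mul p q) :> D.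
Proof. exact: (double_in_dual_pure S_inj). Qed.

Lemma double_dual_in p h : double_in_dual p *D double_in h = (p ⊗ h : D).
Proof. by rewrite (double_in_dual_pure S_inj) dual_mulp1. Qed.

Lemma T_double_gM h : g *D double_in h = double_in (gT * h).
Proof. exact: (double_in_gM S_inj SM giK gKi comul_g). Qed.

Lemma T_double_xM h : x *D double_in h = double_in (xT * h).
Proof. exact: (double_in_xM S_inj SM giK gKi comul_g comul_x). Qed.

(** Functionals are reduced to X^a G^b by Fourier inversion. This serves twice: for surjectivity of
    the evaluation of words and for uniqueness of morphisms with given values on the generators. *)
Lemma T_double_ind (P : D -> Prop) :
    (forall (c : K) (u v : D), P u -> P v -> P (c *: u + v)) ->
    (forall u v : D, P u -> P v -> P (u *D v)) ->
    P e -> P g -> P x -> P G -> P X -> forall d, P d.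
Proof.
move=> Plin PM P1 Pg Px PG PX.
have P0 : P 0 by have := Plin (-1) _ _ P1 P1; rewrite scaleN1r addNr.
have PD (u v : D) : P u -> P v -> P (u + v).
  by move=> Pu Pv; rewrite -[u]scale1r; apply: Plin.
apply: (double_ind S_inj SM giK gKi comul_g comul_x (T_ind TP)) => // p.
rewrite (dual_mon_span TP zetaP GTP XTP p) (lin_sum double_in_dual_lin).
elim/big_ind: _ => // a _; rewrite (lin_sum double_in_dual_lin).
elim/big_ind: _ => // b _; rewrite (linZ double_in_dual_lin) -[_ *: _]addr0.
apply: Plin => //; rewrite /dual_mon.
have Pb : P (double_in_dual (iter b (dual_mul GT) (counit : hdual T))).
  elim: (b : nat) => [|b' IH]; first exact: P1.
  by rewrite iterS -double_in_dual_mul; apply: PM.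
elim: (a : nat) => [|a' IH] //.
by rewrite iterS -double_in_dual_mul; apply: PM.
Qed.

Lemma double_G4 : G *D (G *D (G *D G)) = e.
Proof. by rewrite !double_in_dual_mul (dual_G4 TP zetaP GTP). Qed.

Lemma double_g4 : g *D (g *D (g *D g)) = e.
Proof. by rewrite !T_double_gM; congr (double_in _); apply: (T_g4 TP). Qed.

Lemma double_xx : x *D x = g *D g - e.
Proof. by rewrite T_double_xM T_double_gM (T_xx TP) (linB double_in_lin). Qed.

Lemma double_XX : X *D X = 0.
Proof. by rewrite double_in_dual_mul (dual_XX TP XTP) (lin0 double_in_dual_lin). Qed.

Lemma double_gx : g *D x = - (x *D g).
Proof. by rewrite T_double_gM T_double_xM (T_gx TP) (linN double_in_lin). Qed.

Lemma double_GX : G *D X = zeta *: (X *D G).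
Proof.
by rewrite !double_in_dual_mul (dual_GX TP zetaP GTP XTP) (linZ double_in_dual_lin).
Qed.

Lemma double_gG : g *D G = G *D g.
Proof.
rewrite (double_in_g_pure S_inj SM giK gKi comul_g) mulr1.
by rewrite (dual_act_conj_G TP GTP) double_dual_in.
Qed.

Lemma double_gX : g *D X = - (X *D g).
Proof.
rewrite (double_in_g_pure S_inj SM giK gKi comul_g) mulr1.
by rewrite (dual_act_conj_X TP XTP) (linN (pure_linl _)) double_dual_in.
Qed.

(** By the three-term action, xX is -g + Xx + G^2, one summand for each operator at X. *)
Lemma double_xX : x *D X - X *D x = G *D G - g.
Proof.
rewrite (double_in_x_pure S_inj SM giK gKi comul_g comul_x) !mulr1 double_dual_in.
rewrite (dual_act_x_X TP XTP) (dual_act_1g_X TP XTP) (dual_act_1x_X TP zetaP GTP XTP).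
rewrite (linN (pure_linl _)) double_in_dual_mul addrAC addrK addrC.
by [].
Qed.

(** Here the three summands of xG are -2 XGg, zeta Gx and -2 XG^3; the outer two combine to the
    right-hand side. *)
Lemma double_xG :
  x *D G - zeta *: (G *D x) = - 2%:R *: (X *D G *D (g + G *D G)).
Proof.
have [_ dr] := bilD.
rewrite (double_in_x_pure S_inj SM giK gKi comul_g comul_x) !mulr1 double_dual_in.
rewrite (dual_act_x_G TP zetaP GTP XTP) (dual_act_1g_G TP zetaP GTP).
rewrite (dual_act_1x_G TP zetaP GTP XTP) !(linZ (pure_linl _)).
rewrite !double_in_dual_mul (linD (dr _)) double_dual_in double_in_dual_mul.
by rewrite addrAC addrK -!dual_mulA scalerDr.
Qed.

Lemma double_relations (R : lalgType K) (phi : R -> D) (g' x' G' X' : R) :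
    alg_morphism *%R 1 (@double_mul K T) e phi ->
    phi g' = g -> phi x' = x -> phi G' = G -> phi X' = X ->
  let E := double_rels zeta g' x' G' X' in
  forall i, (i < size E)%N -> phi (nth (0, 0) E i).1 = phi (nth (0, 0) E i).2.
Proof.
move=> [lphi phi1 phiM] eg ex eG eX E i.
have phi4 p : phi (p ^+ 4) = phi p *D (phi p *D (phi p *D phi p)).
  by rewrite !exprS expr0 mulr1 !phiM.
have phi2 p : phi (p ^+ 2) = phi p *D phi p by rewrite expr2 phiM.
do 10?[case: i => [_|i] /=]; last by [].
- by rewrite phi4 phi1 eG double_G4.
- by rewrite phi4 phi1 eg double_g4.
- by rewrite (linB lphi) !phi2 phi1 eg ex double_xx.
- by rewrite phi2 eX (lin0 lphi) double_XX.
- by rewrite (linN lphi) !phiM eg ex double_gx.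
- by rewrite (linZ lphi) !phiM eG eX double_GX.
- by rewrite !phiM eg eG double_gG.
- by rewrite (linN lphi) !phiM eg eX double_gX.
- by rewrite !(linB lphi) phi2 !phiM eg ex eG eX double_xX.
- rewrite (linB lphi) !(linZ lphi) (phiM _ (_ + _)) (linD lphi) phi2 !phiM eg ex eG eX.
  exact: double_xG.
Qed.

Lemma double_dim : \dim {:D} = 64%N.
Proof.
have dimT := T_dim TP.
have dimH : \dim {:hdual T} = 8%N.
  by rewrite dimvf /= /dim /= -dimvf dimT.
by rewrite dimvf; rewrite /dim /= dimT dimH.
Qed.

Local Notation tmulD := (tmul (@double_mul K T) (@double_mul K T)).

Lemma double_comul_morphism :
  alg_morphism (@double_mul K T) e tmulD (e ⊗ e) (@double_comul K T).
Proof.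
split; [by move=> c u v; rewrite linearP| |].
  rewrite -[e]/(double_in_dual (counit : hdual T)) double_comul_in_dual dual_comul1.
  exact: double_comul2_pure.
exact: (double_comulM S_inj SM giK gKi comul_g comul_x (T_ind TP)).
Qed.

Lemma double_comul_G : double_comul T G =
  G ⊗ G - 2 *: ((X *D G) ⊗ (X *D (G *D G *D G))).
Proof.
have [cl _] := double_comul2_bilin (H := T).
rewrite double_comul_in_dual (dual_comul_G TP zetaP GTP XTP).
rewrite (linB (cl _)) (linZ (cl _)) !double_comul2_pure.
by rewrite !double_in_dual_mul -(dual_mulA GT GT GT).
Qed.

Lemma double_comul_X : double_comul T X = e ⊗ X + X ⊗ (G *D G).
Proof.
have [cl _] := double_comul2_bilin (H := T).
rewrite double_comul_in_dual (dual_comul_X TP zetaP GTP XTP).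
by rewrite (linD (cl _)) !double_comul2_pure double_in_dual_mul.
Qed.

Lemma double_comul_values :
  [/\ double_comul T g = g ⊗ g,
      double_comul T x = g ⊗ x + x ⊗ e,
      double_comul T G = G ⊗ G - 2 *: ((X *D G) ⊗ (X *D (G *D G *D G)))
    & double_comul T X = e ⊗ X + X ⊗ (G *D G)].
Proof.
split; [exact: double_comul_g|exact: double_comul_x| |].
  exact: double_comul_G.
exact: double_comul_X.
Qed.

Lemma double_counit_morphism :
  alg_morphism (@double_mul K T) e *%R (1 : K^o) (@double_counit K T).
Proof.
split; [by move=> c u v; rewrite linearP| |].
  by rewrite double_counitE /fun_of_dual counit1 mulr1.
exact: (double_counitM S_inj SM giK gKi comul_g comul_x (T_ind TP)).
Qed.

Lemma double_counit_values :
  [/\ double_counit T g = 1, double_counit T G = 1,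
      double_counit T x = 0 & double_counit T X = 0].
Proof.
have one : (1 : T) = gT ^+ 0 by rewrite expr0.
rewrite !double_counitE /fun_of_dual counit1 !mulr1 !mul1r; split.
- exact: (counit_g gKi comul_g).
- by rewrite one [LHS](G_g TP zetaP GTP).
- exact: (T_counit_x TP).
- by rewrite one [LHS](X_g TP XTP).
Qed.

Lemma alg_morphism_eq (B : lmodType K) (mulB : B -> B -> B) (oneB : B) (f f' : D -> B) :
    alg_morphism (@double_mul K T) e mulB oneB f ->
    alg_morphism (@double_mul K T) e mulB oneB f' ->
    f g = f' g -> f x = f' x -> f G = f' G -> f X = f' X ->
  f =1 f'.
Proof.
move=> [lf f1 fM] [lf' f'1 f'M] eg ex eG eX.
apply: T_double_ind => // [c u v eu ev|u v eu ev|].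
- by rewrite lf lf' eu ev.
- by rewrite fM f'M eu ev.
by rewrite f1 f'1.
Qed.

End DoubleT421.

Theorem proposition5p6 (K : closedFieldType) (charK0 : [pchar K] =i pred0)
    (zeta : K) (zetaP : 4.-primitive_root zeta)
    (T : hopfAlgType K) (gT xT : T) (TP : is_T421 gT xT)
    (GT XT : hdual T)
    (GTP : forall k l : nat, (k <= 1)%N -> (l <= 3)%N ->
      GT (xT ^+ k * gT ^+ l) = (k == 0%N)%:R * zeta ^+ l)
    (XTP : forall k l : nat, (k <= 1)%N -> (l <= 3)%N ->
      XT (xT ^+ k * gT ^+ l) = (k == 1%N)%:R) :
  let g : drinfeld_double T := double_in gT in
  let x : drinfeld_double T := double_in xT in
  let G : drinfeld_double T := double_in_dual GT in
  let X : drinfeld_double T := double_in_dual XT in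
  let e : drinfeld_double T := double_one T in
  [/\ let g' := fvar K (0 : 'I_4) in
      let x' := fvar K (1 : 'I_4) in
      let G' := fvar K (2 : 'I_4) in
      let X' := fvar K (3 : 'I_4) in
      presented_by (@double_mul K T) e [tuple g; x; G; X]
        [:: (G' ^+ 4, 1); (g' ^+ 4, 1);
            (x' ^+ 2, g' ^+ 2 - 1);
            (X' ^+ 2, 0);
            (g' * x', - (x' * g'));
            (G' * X', zeta *: (X' * G'));
            (g' * G', G' * g');
            (g' * X', - (X' * g'));
            (x' * X' - X' * x', G' ^+ 2 - g');
            (x' * G' - zeta *: (G' * x'),
              - 2 *: (X' * G' * (g' + G' ^+ 2)))],
      alg_morphism_determined_by (@double_mul K T) e
        (tmul (@double_mul K T) (@double_mul K T)) (e ⊗ e)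
        (@double_comul K T)
        (fun Delta =>
          [/\ Delta g = g ⊗ g,
              Delta x = g ⊗ x + x ⊗ e,
              Delta G = G ⊗ G - 2 *: ((X *D G) ⊗ (X *D (G *D G *D G)))
            & Delta X = e ⊗ X + X ⊗ (G *D G)])
    & alg_morphism_determined_by (@double_mul K T) e *%R (1 : K^o)
        (@double_counit K T)
        (fun epsilon =>
          [/\ epsilon g = 1, epsilon G = 1, epsilon x = 0 & epsilon X = 0])].
Proof.
move=> g x G X e.
have bilD := double_mul_bilin (H := T).
have mulA := T_double_mulA TP; have mul1 := T_double_mul1 TP.
have mulr1 := T_double_mulr1 TP.
pose phi := free_eval (@double_mul K T) e (tnth [tuple g; x; G; X]).
have phiP : alg_morphism *%R 1 (@double_mul K T) e phi by exact: free_eval_morphism.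
have phis i : phi (fvar K i) = tnth [tuple g; x; G; X] i by exact: free_eval_var.
have [lphi phi1 phiM] := phiP.
have eg : phi (fvar K 0) = g by rewrite phis.
have ex : phi (fvar K 1) = x by rewrite phis.
have eG : phi (fvar K 2) = G by rewrite phis.
have eX : phi (fvar K 3) = X by rewrite phis.
split.
- move=> g' x' G' X'.
  have span p := @double_rels_span K _ zeta g' x' G' X' (@free_scalerAr K 4) p.
  apply: (presented_by_dim (E := double_rels zeta g' x' G' X')
    (M := mulX X' 2 (mulX G' 4 (mulX x' 2 (mulX g' 4 [:: 1])))) phiP bilD phis).
  (* The image of [phi] is a subalgebra containing the four generators. *)
  + apply: (T_double_ind TP zetaP GTP XTP)
      => [c u v [p <-] [q <-]|u v [p <-] [q <-]|||||].
    * by exists (c *: p + q); rewrite lphi.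
    * by exists (p * q); rewrite phiM.
    * by exists 1.
    * by exists g'.
    * by exists x'.
    * by exists G'.
    * by exists X'.
  + exact: (double_relations TP zetaP GTP XTP phiP eg ex eG eX).
  (* Modulo the relations, 1 lies in the span of the normal words and each letter preserves this
     span from the left. *)
  + apply: free_ind.
    * exact: cspan_lin.
    * exact: MX_1 (@free_scalerAr K 4) g' x' G' X'.
    * move=> i p /span[gp xp Gp Xp].
      have [->|[->|[->|->]]] : i = 0 \/ i = 1 \/ i = 2 \/ i = 3.
        case: i {gp xp Gp Xp} => [[|[|[|[|//]]]] i4];
          [left|right; left|do 2!right; left|].
        * exact: val_inj.
        * exact: val_inj.
        * exact: val_inj.
        * by do 3!right; apply: val_inj.
      - exact: gp.
      - exact: xp.
      - exact: Gp.
      - exact: Xp.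
  (* Both numbers are 64: there are 2·4·2·4 normal words, and the double has dimension 8·8. *)
  + by rewrite (double_dim TP).
- split; first exact: (double_comul_morphism TP).
    exact: (double_comul_values TP zetaP GTP XTP).
  move=> f' fP [fg fx fG fX]; apply: (alg_morphism_eq TP zetaP GTP XTP fP).
  + exact: (double_comul_morphism TP).
  + by rewrite fg; have [-> _ _ _] := double_comul_values TP zetaP GTP XTP.
  + by rewrite fx; have [_ -> _ _] := double_comul_values TP zetaP GTP XTP.
  + by rewrite fG; have [_ _ -> _] := double_comul_values TP zetaP GTP XTP.
  + by rewrite fX; have [_ _ _ ->] := double_comul_values TP zetaP GTP XTP.
split; first exact: (double_counit_morphism TP).
  exact: (double_counit_values TP zetaP GTP XTP).
move=> f' fP [fg fG fx fX]; apply: (alg_morphism_eq TP zetaP GTP XTP fP).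
- exact: (double_counit_morphism TP).
- by rewrite fg; have [-> _ _ _] := double_counit_values TP zetaP GTP XTP.
- by rewrite fx; have [_ _ -> _] := double_counit_values TP zetaP GTP XTP.
- by rewrite fG; have [_ -> _ _] := double_counit_values TP zetaP GTP XTP.
by rewrite fX; have [_ _ _ ->] := double_counit_values TP zetaP GTP XTP.
Qed.
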